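(* For the rotating Kepler problem the flag curvature can become negative: with angular velocity $a=1$, there exist an energy parameter $c>\frac32$, a point $(x,y)$ with $x>0$, and a nonzero tangent vector $(u,v)$ at that point with $v\neq 0$, such that the flag curvature $K$ of the Finsler metric $F$ Legendre dual to $F^*_{c,1}$ satisfies $K(x,y,u,v)<0$.
   Context: Polar coordinates $(x,y)$ on the $p$-plane ($p_1=x\cos y$, $p_2=x\sin y$), with cotangent fiber coordinates $(r,t)$ defined by $r\,dx+t\,dy=q_1dp_1+q_2dp_2$ and tangent fiber coordinates $(u,v)$. The Cartan fundamental function of the rotating Kepler problem (angular velocity $1$, energy $-c$, $c>3/2$) is $$F^*_{c,1}(x,y,r,t)=\frac14(x^2+2c)\sqrt{r^2+\tfrac{t^2}{x^2}}\left(1+\sqrt{1-\frac{16\,t}{\sqrt{r^2+\frac{t^2}{x^2}}\,(x^2+2c)^2}}\right),$$ which is fiberwise strictly convex and positively $1$-homogeneous. Let $\mathcal{L}^*=\frac12(F^*_{c,1})^2$, let $\mathcal{L}(x,y,u,v)=\frac12F^2$ be its fiberwise Legendre transform ($u=\mathcal{L}^*_r$, $v=\mathcal{L}^*_t$), so $F$ is a Finsler metric. Let $D=\mathcal{L}_{uu}\mathcal{L}_{vv}-\mathcal{L}_{uv}^2$ and define spray coefficients $$2G=\tfrac{1}{D}\big(\mathcal{L}_{vv}\mathcal{L}_x-\mathcal{L}_{vx}\mathcal{L}_v-\mathcal{L}_{uv}\mathcal{L}_y+\mathcal{L}_{uy}\mathcal{L}_v\big),\quad 2H=\tfrac{1}{D}\big(\mathcal{L}_{uu}\mathcal{L}_y-\mathcal{L}_{uy}\mathcal{L}_u-\mathcal{L}_{vu}\mathcal{L}_x+\mathcal{L}_{vx}\mathcal{L}_u\big).$$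 The flag curvature (a function on the slit tangent bundle of the surface; subscripts are partial derivatives in the independent variables $x,y,u,v$) is, where $v\neq0$, $$K=\frac{(G_{xv}-G_{yu})\,v+2GG_{uu}+2HG_{uv}-G_uG_u-G_vH_u}{v\,\mathcal{L}_v}.$$ *)

(* Defs.v *)
From Stdlib Require Import Reals Lra ClassicalEpsilon.
Open Scope R_scope.

Definition fn4 := R -> R -> R -> R -> R.

(* One-variable slice of f through (a,b,c,d) in coordinate i
   (0 = x, 1 = y, 2 = u (or r), 3 = v (or t)). *)
Definition slice (i : nat) (f : fn4) (a b c d : R) : R -> R :=
  match i with
  | 0 => fun s => f s b c d
  | 1 => fun s => f a s c d
  | 2 => fun s => f a b s d
  | _ => fun s => f a b c s
  end.

Definition coord (i : nat) (a b c d : R) : R :=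
  match i with 0 => a | 1 => b | 2 => c | _ => d end.

(* i-th partial derivative (the value of the derivative when it exists;
   uniqueness of derivatives makes this well defined; junk 0-ish otherwise). *)
Definition pd (i : nat) (f : fn4) : fn4 := fun a b c d =>
  epsilon (inhabits 0)
    (fun l => derivable_pt_lim (slice i f a b c d) (coord i a b c d) l).

Fixpoint HasPartials (n : nat) (U : R -> R -> R -> R -> Prop) (f : fn4) : Prop :=
  match n with
  | O => True
  | S m =>
      (forall i, (i < 4)%nat -> forall a b c d, U a b c d ->
         exists l, derivable_pt_lim (slice i f a b c d) (coord i a b c d) l)
      /\ (forall i, (i < 4)%nat -> HasPartials m U (pd i f))
  end.

Definition box (e x0 y0 u0 v0 : R) : R -> R -> R -> R -> Prop :=
  fun a b c d => Rabs (a - x0) < e /\ Rabs (b - y0) < e /\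
                 Rabs (c - u0) < e /\ Rabs (d - v0) < e.

Definition supR (P : R -> Prop) : R := epsilon (inhabits 0) (fun l => is_lub P l).

Definition Fstar (c : R) : fn4 := fun x y r t =>
  let rho := sqrt (r ^ 2 + t ^ 2 / x ^ 2) in
  / 4 * (x ^ 2 + 2 * c) * rho *
  (1 + sqrt (1 - 16 * t / (rho * (x ^ 2 + 2 * c) ^ 2))).

Definition Lstar (c : R) : fn4 := fun x y r t => / 2 * (Fstar c x y r t) ^ 2.

Definition Lag (c : R) : fn4 := fun x y u v =>
  supR (fun z => exists r t, z = r * u + t * v - Lstar c x y r t).

Definition Dm (c : R) : fn4 := fun x y u v =>
  pd 2 (pd 2 (Lag c)) x y u v * pd 3 (pd 3 (Lag c)) x y u v
  - (pd 3 (pd 2 (Lag c)) x y u v) ^ 2.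

(* L_{ab} denotes d_b d_a L *)
Definition Gsp (c : R) : fn4 := fun x y u v =>
  let L := Lag c in
  / 2 * (/ Dm c x y u v) *
  ( pd 3 (pd 3 L) x y u v * pd 0 L x y u v
  - pd 0 (pd 3 L) x y u v * pd 3 L x y u v
  - pd 3 (pd 2 L) x y u v * pd 1 L x y u v
  + pd 1 (pd 2 L) x y u v * pd 3 L x y u v).

Definition Hsp (c : R) : fn4 := fun x y u v =>
  let L := Lag c in
  / 2 * (/ Dm c x y u v) *
  ( pd 2 (pd 2 L) x y u v * pd 1 L x y u v
  - pd 1 (pd 2 L) x y u v * pd 2 L x y u v
  - pd 2 (pd 3 L) x y u v * pd 0 L x y u v
  + pd 0 (pd 3 L) x y u v * pd 2 L x y u v).

(* flag curvature (where v <> 0) *)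
Definition Kflag (c : R) : fn4 := fun x y u v =>
  let G := Gsp c in let H := Hsp c in
  ( (pd 3 (pd 0 G) x y u v - pd 2 (pd 1 G) x y u v) * v
    + 2 * G x y u v * pd 2 (pd 2 G) x y u v
    + 2 * H x y u v * pd 3 (pd 2 G) x y u v
    - pd 2 G x y u v * pd 2 G x y u v
    - pd 3 G x y u v * pd 2 H x y u v )
  / (v * pd 3 (Lag c) x y u v).

(* Main.v *)
Require Import Defs.
From Stdlib Require Import Reals Ranalysis5 Lra Lia QArith Qreals ClassicalEpsilon List.
From Coquelicot Require Import Coquelicot.
Import ListNotations.
Open Scope R_scope.

(** Negative curvature occurs close to the critical energy: at [c = 199/128], [x = 5/8],
    [u = 0], [v = 1] the flag curvature is [-25/6]. In terms of [a = x^2/2 + c] and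
    [rho^2 = r^2 + t^2/x^2] the curve [F* = 1] is [1/rho + t = a] (the Kepler energy surface),
    so with [s = 1/rho] as a parameter both the dual direction [(u/v)^2] and the Finsler norm
    [F/v] are rational functions of [(x, s)]. Inverting [s |-> (u/v)^2] by the implicit
    function theorem makes the Lagrangian a function [v^2 f(x, (u/v)^2)^2 / 2] all of whose
    partial derivatives are rational expressions, and the curvature is then an exact
    computation with rational numbers. *)

(** * Partial derivatives *)

(** Three obstacles shape the proof. The Lagrangian is a supremum over a whole fibre, so a critical
    point of the Legendre problem is not enough: a global supporting line inequality is proved for
    the curve [F* = 1]. The quantities [pd] and [supR] are values of a choice operator, so each
    closed formula has to hold on a box before it can be differentiated again. Finally, u/v involves
    the square root of x^2 - (s t)^2, which vanishes at the base point; the square (u/v)^2 is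
    rational there and has nonzero [s]-derivative, so it is the square that is inverted.

    The constants keep everything rational. At x = 5/8 one has a = 7/4 and a^2 - 4 x = (3/4)^2, so
    the equation s (a - s) = x, which says r = 0 and hence u = 0, has the root s = 5/4 with t = 1/2.
    Taking u = 0 also removes most terms of the curvature. *)

Lemma Rabs_lt_iff a d : Rabs a < d <-> -d < a < d.
Proof. unfold Rabs; destruct Rcase_abs; lra. Qed.

Lemma pd_unique i f a b c d l :
  derivable_pt_lim (slice i f a b c d) (coord i a b c d) l -> pd i f a b c d = l.
Proof.
  intro H. unfold pd.
  apply (uniqueness_limite (slice i f a b c d) (coord i a b c d)); [|exact H].
  apply (epsilon_spec (inhabits 0)
    (fun l => derivable_pt_lim (slice i f a b c d) (coord i a b c d) l)).
  now exists l.
Qed.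

Definition open4 (U : R -> R -> R -> R -> Prop) : Prop :=
  forall a b c d, U a b c d -> exists e, 0 < e /\
    forall a' b' c' d', box e a b c d a' b' c' d' -> U a' b' c' d'.

Lemma box_open e x y u v : open4 (box e x y u v).
Proof.
  intros a b c d (Ha & Hb & Hc & Hd).
  exists (Rmin (Rmin (e - Rabs (a - x)) (e - Rabs (b - y)))
               (Rmin (e - Rabs (c - u)) (e - Rabs (d - v)))).
  split; [repeat apply Rmin_pos; lra|].
  intros a' b' c' d' (Ha' & Hb' & Hc' & Hd').
  assert (HT : forall p q r m, Rabs (p - q) < m -> m <= e - Rabs (q - r) -> Rabs (p - r) < e).
  { intros p q r m H1 H2. replace (p - r) with ((p - q) + (q - r)) by ring.
    eapply Rle_lt_trans; [apply Rabs_triang|lra]. }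
  set (m1 := Rmin (e - Rabs (a - x)) (e - Rabs (b - y))) in *.
  set (m2 := Rmin (e - Rabs (c - u)) (e - Rabs (d - v))) in *.
  pose proof (Rmin_l m1 m2). pose proof (Rmin_r m1 m2).
  pose proof (Rmin_l (e - Rabs (a - x)) (e - Rabs (b - y))).
  pose proof (Rmin_r (e - Rabs (a - x)) (e - Rabs (b - y))).
  pose proof (Rmin_l (e - Rabs (c - u)) (e - Rabs (d - v))).
  pose proof (Rmin_r (e - Rabs (c - u)) (e - Rabs (d - v))).
  fold m1 in H1, H2. fold m2 in H3, H4.
  repeat split; eapply HT; eauto; lra.
Qed.

Lemma box_center e x y u v : 0 < e -> box e x y u v x y u v.
Proof. intro H; unfold box; rewrite !Rminus_diag, Rabs_R0; auto. Qed.

Lemma box_mono e e' x y u v a b c d :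
  e <= e' -> box e x y u v a b c d -> box e' x y u v a b c d.
Proof. intros H (H1 & H2 & H3 & H4); repeat split; lra. Qed.

Lemma slice_coord i f a b c d : slice i f a b c d (coord i a b c d) = f a b c d.
Proof. destruct i as [|[|[|i]]]; reflexivity. Qed.

Lemma slice_locally (U : R -> R -> R -> R -> Prop) i f g a b c d :
  open4 U -> U a b c d -> (forall a b c d, U a b c d -> f a b c d = g a b c d) ->
  locally (coord i a b c d) (fun s => slice i f a b c d s = slice i g a b c d s).
Proof.
  intros HU Hp Hfg. destruct (HU _ _ _ _ Hp) as (e & He & Hb).
  exists (mkposreal e He). intros s Hs.
  assert (Hs' : Rabs (s - coord i a b c d) < e) by exact Hs.
  pose proof (box_center e a b c d He) as (H1 & H2 & H3 & H4).
  destruct i as [|[|[|i]]]; simpl in *; apply Hfg, Hb; repeat split; assumption.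
Qed.

(** Openness drives the induction: a partial derivative at a point depends only on nearby values, so
    agreement on [U] passes to the partial derivatives, again on all of [U]. *)
Lemma HasPartials_ext n U f g : open4 U ->
  (forall a b c d, U a b c d -> f a b c d = g a b c d) ->
  HasPartials n U f -> HasPartials n U g.
Proof.
  intro HU. revert f g; induction n as [|n IH]; intros f g Hfg; [easy|].
  intros [Hd Hn].
  assert (HT : forall i l a b c d, U a b c d ->
     derivable_pt_lim (slice i f a b c d) (coord i a b c d) l ->
     derivable_pt_lim (slice i g a b c d) (coord i a b c d) l).
  { intros i l a b c d Hp Hl. apply is_derive_Reals. apply is_derive_Reals in Hl.
    eapply is_derive_ext_loc; [|exact Hl]. now apply slice_locally with U. }
  split.
  - intros i Hi a b c d Hp. destruct (Hd i Hi a b c d Hp) as [l Hl].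
    exists l; auto.
  - intros i Hi. apply IH with (pd i f); [|now apply Hn].
    intros a b c d Hp. destruct (Hd i Hi a b c d Hp) as [l Hl].
    rewrite (pd_unique _ _ _ _ _ _ _ Hl). symmetry. apply pd_unique. auto.
Qed.

(** * Rational expressions in differentiable atoms *)

(** Reified syntax lets differentiation and rational evaluation run as programs; [T] is a type of
    atoms whose derivatives are given separately. *)
Inductive expr (T : Type) : Type :=
| Cst (q : Q) | Var (t : T)
| Add (e1 e2 : expr T) | Mul (e1 e2 : expr T) | Inv (e : expr T).
Arguments Cst {T}. Arguments Var {T}. Arguments Add {T}. Arguments Mul {T}. Arguments Inv {T}.

Definition is_zero {T} (e : expr T) : bool :=
  match e with Cst q => Qeq_bool q 0 | _ => false end.
Definition is_one {T} (e : expr T) : bool :=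
  match e with Cst q => Qeq_bool q 1 | _ => false end.
(** Pruning zeros and ones during construction limits the growth of iterated derivatives. *)
Definition sadd {T} (e1 e2 : expr T) : expr T :=
  if is_zero e1 then e2 else if is_zero e2 then e1 else Add e1 e2.
Definition smul {T} (e1 e2 : expr T) : expr T :=
  if is_zero e1 then Cst 0 else if is_zero e2 then Cst 0
  else if is_one e1 then e2 else if is_one e2 then e1 else Mul e1 e2.
Definition sopp {T} (e : expr T) : expr T := smul (Cst (-1)) e.
Definition ssub {T} (e1 e2 : expr T) : expr T := sadd e1 (sopp e2).

Local Arguments Qred : simpl never.
Local Arguments Qplus : simpl never.
Local Arguments Qmult : simpl never.
Local Arguments Qinv : simpl never.

Definition oadd (p q : option Q) : option Q :=
  match p, q with Some a, Some b => Some (Qred (a + b)) | _, _ => None end.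
(* [None] stands for an unknown value; zero absorbs it. *)
Definition omul (p q : option Q) : option Q :=
  match p, q with
  | Some a, Some b => Some (Qred (a * b))
  | Some a, None | None, Some a => if Qeq_bool a 0 then Some 0%Q else None
  | None, None => None
  end.
Definition oinv (p : option Q) : option Q :=
  match p with
  | Some a => if Qeq_bool a 0 then None else Some (Qred (/ a))
  | None => None
  end.

Fixpoint evalQ {T} (env : T -> option Q) (e : expr T) : option Q :=
  match e with
  | Cst q => Some q
  | Var t => env t
  | Add e1 e2 => oadd (evalQ env e1) (evalQ env e2)
  | Mul e1 e2 => omul (evalQ env e1) (evalQ env e2)
  | Inv e => oinv (evalQ env e)
  end.

Fixpoint deriv {T} (dv : T -> expr T) (e : expr T) : expr T :=
  match e with
  | Cst _ => Cst 0
  | Var t => dv t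
  | Add e1 e2 => sadd (deriv dv e1) (deriv dv e2)
  | Mul e1 e2 => sadd (smul (deriv dv e1) e2) (smul e1 (deriv dv e2))
  | Inv e => sopp (smul (deriv dv e) (smul (Inv e) (Inv e)))
  end.

Fixpoint den {T} (env : T -> fn4) (e : expr T) : fn4 :=
  match e with
  | Cst q => fun _ _ _ _ => Q2R q
  | Var t => env t
  | Add e1 e2 => fun a b c d => den env e1 a b c d + den env e2 a b c d
  | Mul e1 e2 => fun a b c d => den env e1 a b c d * den env e2 a b c d
  | Inv e => fun a b c d => / den env e a b c d
  end.

Lemma Q2R_0 : Q2R 0 = 0.
Proof. unfold Q2R; simpl; lra. Qed.
Lemma Q2R_1 : Q2R 1 = 1.
Proof. unfold Q2R; simpl; lra. Qed.

Lemma Q2R_Qred q : Q2R (Qred q) = Q2R q.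
Proof. apply Qeq_eqR, Qred_correct. Qed.

Lemma is_zero_den {T} env (e : expr T) a b c d : is_zero e = true -> den env e a b c d = 0.
Proof.
  destruct e; simpl; try discriminate. intro H. apply Qeq_bool_eq in H.
  now rewrite (Qeq_eqR _ _ H), Q2R_0.
Qed.

Lemma is_one_den {T} env (e : expr T) a b c d : is_one e = true -> den env e a b c d = 1.
Proof.
  destruct e; simpl; try discriminate. intro H. apply Qeq_bool_eq in H.
  now rewrite (Qeq_eqR _ _ H), Q2R_1.
Qed.

Lemma den_sadd {T} env (e1 e2 : expr T) a b c d :
  den env (sadd e1 e2) a b c d = den env e1 a b c d + den env e2 a b c d.
Proof.
  unfold sadd. destruct (is_zero e1) eqn:E1.
  { rewrite (is_zero_den env e1) by assumption; lra. }
  destruct (is_zero e2) eqn:E2; [|reflexivity].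
  rewrite (is_zero_den env e2) by assumption; lra.
Qed.

Lemma den_smul {T} env (e1 e2 : expr T) a b c d :
  den env (smul e1 e2) a b c d = den env e1 a b c d * den env e2 a b c d.
Proof.
  unfold smul. destruct (is_zero e1) eqn:E1.
  { rewrite (is_zero_den env e1) by assumption; simpl; rewrite Q2R_0; lra. }
  destruct (is_zero e2) eqn:E2.
  { rewrite (is_zero_den env e2) by assumption; simpl; rewrite Q2R_0; lra. }
  destruct (is_one e1) eqn:E3.
  { rewrite (is_one_den env e1) by assumption; lra. }
  destruct (is_one e2) eqn:E4; [|reflexivity].
  rewrite (is_one_den env e2) by assumption; lra.
Qed.

Lemma den_sopp {T} env (e : expr T) a b c d :
  den env (sopp e) a b c d = - den env e a b c d.
Proof. unfold sopp; rewrite den_smul; simpl; unfold Q2R; simpl; lra. Qed.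

Lemma den_ssub {T} env (e1 e2 : expr T) a b c d :
  den env (ssub e1 e2) a b c d = den env e1 a b c d - den env e2 a b c d.
Proof. unfold ssub; rewrite den_sadd, den_sopp; lra. Qed.

(** Nonvanishing of every inverted subexpression is the only side condition for continuity and
    differentiability of an expression. *)
Fixpoint wf {T} (env : T -> fn4) (U : R -> R -> R -> R -> Prop) (e : expr T) : Prop :=
  match e with
  | Cst _ | Var _ => True
  | Add e1 e2 | Mul e1 e2 => wf env U e1 /\ wf env U e2
  | Inv e => wf env U e /\ forall a b c d, U a b c d -> den env e a b c d <> 0
  end.

Lemma wf_sadd {T} env U (e1 e2 : expr T) : wf env U e1 -> wf env U e2 -> wf env U (sadd e1 e2).
Proof. unfold sadd; intros; destruct (is_zero e1), (is_zero e2); simpl; auto. Qed.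
Lemma wf_smul {T} env U (e1 e2 : expr T) : wf env U e1 -> wf env U e2 -> wf env U (smul e1 e2).
Proof.
  unfold smul; intros; destruct (is_zero e1), (is_zero e2), (is_one e1), (is_one e2); simpl; auto.
Qed.
Lemma wf_sopp {T} env U (e : expr T) : wf env U e -> wf env U (sopp e).
Proof. intro; apply wf_smul; simpl; auto. Qed.
Lemma wf_ssub {T} env U (e1 e2 : expr T) : wf env U e1 -> wf env U e2 -> wf env U (ssub e1 e2).
Proof. intros; apply wf_sadd; [|apply wf_sopp]; auto. Qed.

Lemma wf_deriv {T} env U dv (e : expr T) :
  (forall t, wf env U (dv t)) -> wf env U e -> wf env U (deriv dv e).
Proof.
  intro H; induction e; simpl; intuition;
  repeat (apply wf_sopp || apply wf_sadd || apply wf_smul); simpl; auto.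
Qed.

(** Atoms of unknown value still denote real numbers, so a product with zero is zero; this makes the
    absorption in [omul] sound. *)
Lemma evalQ_correct {T} env U (ev : T -> option Q) (e : expr T) a b c d q :
  U a b c d -> (forall t r, ev t = Some r -> env t a b c d = Q2R r) ->
  evalQ ev e = Some q -> den env e a b c d = Q2R q.
Proof.
  intros Hp He. revert q; induction e as [r|t|e1 IH1 e2 IH2|e1 IH1 e2 IH2|e IH]; intros q; simpl.
  - now intros [= ->].
  - apply He.
  - destruct (evalQ ev e1) as [r1|], (evalQ ev e2) as [r2|]; simpl; try discriminate.
    intro E; injection E as <-. rewrite Q2R_Qred, Q2R_plus, (IH1 r1), (IH2 r2); auto.
  - destruct (evalQ ev e1) as [r1|], (evalQ ev e2) as [r2|]; simpl; try discriminate.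
    + intros [= <-]. rewrite Q2R_Qred, Q2R_mult, (IH1 r1), (IH2 r2); auto.
    + destruct (Qeq_bool r1 0) eqn:E; [|discriminate]. intros [= <-].
      rewrite (IH1 r1), (Qeq_eqR _ _ (Qeq_bool_eq _ _ E)), Q2R_0 by auto; lra.
    + destruct (Qeq_bool r2 0) eqn:E; [|discriminate]. intros [= <-].
      rewrite (IH2 r2), (Qeq_eqR _ _ (Qeq_bool_eq _ _ E)), Q2R_0 by auto; lra.
  - destruct (evalQ ev e) as [r|]; simpl; [|discriminate].
    destruct (Qeq_bool r 0) eqn:E; [discriminate|]. intros [= <-].
    rewrite Q2R_Qred, Q2R_inv, (IH r); auto.
    intro H. rewrite H in E. discriminate.
Qed.

(** * Joint continuity of expressions *)

Definition unc (f : fn4) (p : R * (R * (R * R))) : R :=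
  f (fst p) (fst (snd p)) (fst (snd (snd p))) (snd (snd (snd p))).

Definition cont4 (f : fn4) (a b c d : R) : Prop := continuous (unc f) (a, (b, (c, d))).

(** Used to extend the sign of a denominator from the base point, where it is computed exactly, to a
    box. *)
Lemma cont4_pos f a b c d : cont4 f a b c d -> 0 < f a b c d ->
  exists e, 0 < e /\ forall a' b' c' d', box e a b c d a' b' c' d' -> 0 < f a' b' c' d'.
Proof.
  intros Hc H0.
  destruct (Hc (ball (f a b c d) (mkposreal _ H0)) (locally_ball _ _)) as [e He].
  exists e; split; [apply cond_pos|].
  intros a' b' c' d' (H1 & H2 & H3 & H4).
  assert (HB : ball (f a b c d) (f a b c d) (f a' b' c' d')).
  { apply (He (a', (b', (c', d')))). repeat split; assumption. }
  change (Rabs (f a' b' c' d' - f a b c d) < f a b c d) in HB.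
  apply Rabs_lt_iff in HB. lra.
Qed.

Lemma continuous_pair {A B C : UniformSpace} (f : A -> B) (g : A -> C) p :
  continuous f p -> continuous g p -> continuous (fun q => (f q, g q)) p.
Proof.
  intros Hf Hg P [e He].
  assert (K1 := Hf _ (locally_ball (f p) e)). assert (K2 := Hg _ (locally_ball (g p) e)).
  unfold filtermap in *. generalize (filter_and _ _ K1 K2).
  apply filter_imp. intros q [H1 H2]. apply He. split; assumption.
Qed.

Lemma cont4_den {T} env U (e : expr T) a b c d : U a b c d ->
  (forall t, cont4 (env t) a b c d) -> wf env U e -> cont4 (den env e) a b c d.
Proof.
  intros Hp Hv; induction e as [r|t|e1 IH1 e2 IH2|e1 IH1 e2 IH2|e IH]; simpl; intro Hw.
  - apply continuous_const.
  - apply Hv.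
  - apply (continuous_plus (unc (den env e1)) (unc (den env e2))); tauto.
  - apply (continuous_mult (unc (den env e1)) (unc (den env e2))); tauto.
  - destruct Hw as [Hw H0].
    apply (continuous_comp (unc (den env e)) Rinv); [tauto|].
    apply continuity_pt_filterlim, continuity_pt_inv; [|now apply H0].
    apply continuity_pt_id.
Qed.

(** * Derivatives of expressions of every order *)

Section Differentiation.

Variables (T : Type) (env : T -> fn4) (dv : nat -> T -> expr T)
  (U : R -> R -> R -> R -> Prop).

(** The atoms form a system closed under differentiation: each partial derivative of an atom is
    again an expression in the atoms. *)
Definition differential : Prop :=
  (forall i t, (i < 4)%nat -> wf env U (dv i t)) /\
  (forall i t a b c d, (i < 4)%nat -> U a b c d ->
     is_derive (slice i (env t) a b c d) (coord i a b c d) (den env (dv i t) a b c d)).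

Hypothesis Hopen : open4 U.
Hypothesis Hdiff : differential.

Lemma den_deriv i e a b c d : (i < 4)%nat -> U a b c d -> wf env U e ->
  is_derive (slice i (den env e) a b c d) (coord i a b c d)
    (den env (deriv (dv i) e) a b c d).
Proof.
  intros Hi Hp; induction e as [r|t|e1 IH1 e2 IH2|e1 IH1 e2 IH2|e IH]; simpl; intro Hw.
  - rewrite Q2R_0. destruct i as [|[|[|i]]]; apply @is_derive_const.
  - now apply Hdiff.
  - rewrite den_sadd.
    apply (is_derive_ext (fun s =>
      slice i (den env e1) a b c d s + slice i (den env e2) a b c d s)).
    { destruct i as [|[|[|i]]]; reflexivity. }
    apply (is_derive_plus (slice i (den env e1) a b c d) (slice i (den env e2) a b c d)); tauto.
  - rewrite den_sadd, !den_smul.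
    apply (is_derive_ext (fun s =>
      slice i (den env e1) a b c d s * slice i (den env e2) a b c d s)).
    { destruct i as [|[|[|i]]]; reflexivity. }
    rewrite <- (slice_coord i (den env e1)), <- (slice_coord i (den env e2)).
    apply (is_derive_mult (slice i (den env e1) a b c d) (slice i (den env e2) a b c d));
      [tauto|tauto|apply Rmult_comm].
  - rewrite den_sopp, !den_smul; simpl.
    destruct Hw as [Hw H0]. specialize (H0 _ _ _ _ Hp).
    apply (is_derive_ext (fun s => / slice i (den env e) a b c d s)).
    { destruct i as [|[|[|i]]]; reflexivity. }
    rewrite <- (slice_coord i (den env e)) in H0 |- *.
    evar_last. { apply is_derive_inv; [apply IH; exact Hw|exact H0]. }
    field. exact H0.
Qed.

(** Equality is demanded on all of [U], not at one point, so that the relation survives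
    differentiation. *)
Definition represents (f : fn4) (e : expr T) : Prop :=
  wf env U e /\ forall a b c d, U a b c d -> f a b c d = den env e a b c d.

Lemma represents_pd i f e : (i < 4)%nat -> represents f e ->
  represents (pd i f) (deriv (dv i) e).
Proof.
  intros Hi [Hw Hf]; split.
  - apply wf_deriv; auto. intro t; now apply (proj1 Hdiff).
  - intros a b c d Hp. apply pd_unique, is_derive_Reals.
    eapply is_derive_ext_loc; [|apply den_deriv; eauto].
    apply slice_locally with U; auto. intros; symmetry; auto.
Qed.

Lemma HasPartials_den n e : wf env U e -> HasPartials n U (den env e).
Proof.
  revert e; induction n as [|n IH]; intros e Hw; [exact I|]. split.
  - intros i Hi a b c d Hp. eexists. apply is_derive_Reals, den_deriv; eauto.
  - intros i Hi.
    assert (He : represents (den env e) e) by (split; auto).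
    destruct (represents_pd i _ _ Hi He) as [Hw' H'].
    apply HasPartials_ext with (den env (deriv (dv i) e)); auto.
    intros; symmetry; auto.
Qed.

Lemma HasPartials_represents n f e : represents f e -> HasPartials n U f.
Proof.
  intros [Hw Hf]. apply HasPartials_ext with (den env e); auto.
  - intros; symmetry; auto.
  - now apply HasPartials_den.
Qed.

End Differentiation.

(** * Implicit functions *)

Section ImplicitFunction.

Variables (F Fx Fs : R -> R -> R) (x0 s0 eta : R).
Hypothesis Heta : 0 < eta.
Hypothesis HFx : forall x s, Rabs (x - x0) < eta -> Rabs (s - s0) < eta ->
  is_derive (fun x => F x s) x (Fx x s).
Hypothesis HFs : forall x s, Rabs (x - x0) < eta -> Rabs (s - s0) < eta ->
  is_derive (fun s => F x s) s (Fs x s).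
Hypothesis Hpos : forall x s, Rabs (x - x0) < eta -> Rabs (s - s0) < eta -> 0 < Fs x s.
Hypothesis Hcx : forall x s, Rabs (x - x0) < eta -> Rabs (s - s0) < eta ->
  continuous (fun p => Fx (fst p) (snd p)) (x, s).
Hypothesis Hcs : forall x s, Rabs (x - x0) < eta -> Rabs (s - s0) < eta ->
  continuous (fun p => Fs (fst p) (snd p)) (x, s).

Lemma interval_between a b c m d : Rabs (a - m) < d -> Rabs (b - m) < d ->
  Rmin a b <= c <= Rmax a b -> Rabs (c - m) < d.
Proof.
  unfold Rmin, Rmax; destruct (Rle_dec a b);
  unfold Rabs; repeat destruct Rcase_abs; lra.
Qed.

Lemma implicit_increasing x s s' : Rabs (x - x0) < eta ->
  Rabs (s - s0) < eta -> Rabs (s' - s0) < eta -> s < s' -> F x s < F x s'.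
Proof.
  intros Hx Hs Hs' Hlt.
  destruct (MVT_gen (F x) s s' (Fs x)) as (c & Hc & E).
  - intros y Hy. apply HFs; auto. apply (interval_between s s'); auto; lra.
  - intros y Hy. apply derivable_continuous_pt. exists (Fs x y). apply is_derive_Reals.
    apply HFs; auto. apply (interval_between s s'); auto.
  - assert (0 < Fs x c) by (apply Hpos; auto; apply (interval_between s s'); auto).
    nra.
Qed.

Lemma implicit_cont_x x s d : Rabs (x - x0) < eta -> Rabs (s - s0) < eta -> 0 < d ->
  exists e, 0 < e /\ forall x', Rabs (x' - x) < e -> Rabs (F x' s - F x s) < d.
Proof.
  intros Hx Hs Hd.
  assert (H : continuous (fun x => F x s) x).
  { apply (ex_derive_continuous (V := R_NormedModule) (fun x => F x s)). eexists. apply HFx; auto. }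
  destruct (H (ball (F x s) (mkposreal d Hd)) (locally_ball _ _)) as [e He].
  exists e; split; [apply cond_pos|]. intros x' Hx'. apply (He x' Hx').
Qed.

(** The choice is restricted to the window around [s0], where strict monotonicity in [s] leaves at
    most one solution. *)
Definition implicit_fun (x z : R) : R :=
  epsilon (inhabits 0) (fun s => Rabs (s - s0) < eta /\ F x s = z).

(** At s0 - h and s0 + h the function F(x0, .) lies strictly below and above F(x0, s0). Half of each
    gap absorbs the change of [x], the other half that of [z], and the intermediate value theorem
    applies between the two points. *)
Lemma implicit_exists : exists e, 0 < e /\ e <= eta /\
  forall x z, Rabs (x - x0) < e -> Rabs (z - F x0 s0) < e ->
    Rabs (implicit_fun x z - s0) < eta /\ F x (implicit_fun x z) = z.
Proof.
  set (h := eta / 2).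
  assert (Hh : 0 < h < eta) by (unfold h; lra).
  assert (K0 : Rabs (x0 - x0) < eta) by (rewrite Rminus_diag, Rabs_R0; lra).
  assert (K1 : Rabs (s0 - h - s0) < eta) by (apply Rabs_lt_iff; lra).
  assert (K2 : Rabs (s0 + h - s0) < eta) by (apply Rabs_lt_iff; lra).
  assert (K3 : Rabs (s0 - s0) < eta) by (rewrite Rminus_diag, Rabs_R0; lra).
  pose proof (implicit_increasing x0 (s0 - h) s0 K0 K1 K3 ltac:(lra)) as L1.
  pose proof (implicit_increasing x0 s0 (s0 + h) K0 K3 K2 ltac:(lra)) as L2.
  destruct (implicit_cont_x x0 (s0 - h) ((F x0 s0 - F x0 (s0 - h)) / 2) K0 K1 ltac:(lra))
    as (e1 & He1 & C1).
  destruct (implicit_cont_x x0 (s0 + h) ((F x0 (s0 + h) - F x0 s0) / 2) K0 K2 ltac:(lra))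
    as (e2 & He2 & C2).
  set (d1 := (F x0 s0 - F x0 (s0 - h)) / 2) in *.
  set (d2 := (F x0 (s0 + h) - F x0 s0) / 2) in *.
  assert (Hd1 : 0 < d1) by (unfold d1; lra).
  assert (Hd2 : 0 < d2) by (unfold d2; lra).
  assert (Ed1 : 2 * d1 = F x0 s0 - F x0 (s0 - h)) by (unfold d1; field).
  assert (Ed2 : 2 * d2 = F x0 (s0 + h) - F x0 s0) by (unfold d2; field).
  set (m := Rmin (Rmin e1 e2) (Rmin d1 d2)).
  pose proof (Rmin_l (Rmin e1 e2) (Rmin d1 d2)) as M1.
  pose proof (Rmin_r (Rmin e1 e2) (Rmin d1 d2)) as M2.
  pose proof (Rmin_l e1 e2). pose proof (Rmin_r e1 e2).
  pose proof (Rmin_l d1 d2). pose proof (Rmin_r d1 d2).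
  fold m in M1, M2.
  assert (Hm : 0 < m) by (unfold m; repeat apply Rmin_pos; lra).
  exists (Rmin m eta).
  pose proof (Rmin_l m eta). pose proof (Rmin_r m eta).
  split; [apply Rmin_pos; lra|]. split; [lra|].
  intros x z Hx Hz.
  apply (epsilon_spec (inhabits 0) (fun s => Rabs (s - s0) < eta /\ F x s = z)).
  specialize (C1 x ltac:(lra)). specialize (C2 x ltac:(lra)).
  apply Rabs_lt_iff in C1, C2, Hz.
  assert (Hx' : Rabs (x - x0) < eta) by lra.
  destruct (IVT_interv (fun s => F x s - z) (s0 - h) (s0 + h)) as (s & Hs & E).
  - intros s Hs. apply derivable_continuous_pt. exists (Fs x s). apply is_derive_Reals.
    evar_last.
    { apply (is_derive_minus (fun s => F x s) (fun _ => z)); [|apply @is_derive_const].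
      apply HFs; auto. apply Rabs_lt_iff; lra. }
    unfold minus, plus, opp, zero; simpl; ring.
  - lra.
  - lra.
  - lra.
  - exists s; split; [apply Rabs_lt_iff; lra|]. lra.
Qed.

Variable e : R.
Hypothesis He : 0 < e <= eta.
Hypothesis Hsol : forall x z, Rabs (x - x0) < e -> Rabs (z - F x0 s0) < e ->
    Rabs (implicit_fun x z - s0) < eta /\ F x (implicit_fun x z) = z.

Let S := implicit_fun.

Lemma implicit_unique x z s : Rabs (x - x0) < e -> Rabs (z - F x0 s0) < e ->
  Rabs (s - s0) < eta -> F x s = z -> S x z = s.
Proof.
  intros Hx Hz Hs E. destruct (Hsol x z Hx Hz) as [H1 H2]. fold (S x z) in *.
  destruct (Rtotal_order (S x z) s) as [L|[L|L]]; auto; exfalso.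
  - pose proof (implicit_increasing x _ _ ltac:(lra) H1 Hs L). lra.
  - pose proof (implicit_increasing x _ _ ltac:(lra) Hs H1 L). lra.
Qed.

(** For (x', z') near (x, z) the values F(x', s - k) and F(x', s + k) still enclose z', so
    monotonicity traps the solution within [k] of [s]. *)
Lemma implicit_continuous x z : Rabs (x - x0) < e -> Rabs (z - F x0 s0) < e ->
  continuous (fun p => S (fst p) (snd p)) (x, z).
Proof.
  intros Hx Hz. destruct (Hsol x z Hx Hz) as [H1 H2]. fold (S x z) in *.
  set (s := S x z) in *.
  intros P [d Hd]. simpl in Hd. fold s in Hd.
  assert (Hdp := cond_pos d).
  set (k := Rmin (d / 2) ((eta - Rabs (s - s0)) / 2)).
  pose proof (Rmin_l (d / 2) ((eta - Rabs (s - s0)) / 2)).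
  pose proof (Rmin_r (d / 2) ((eta - Rabs (s - s0)) / 2)). fold k in H, H0.
  assert (Hk : 0 < k) by (unfold k; apply Rmin_pos; lra).
  assert (K1 : Rabs (s - k - s0) < eta).
  { revert H0; unfold Rabs; repeat destruct Rcase_abs; lra. }
  assert (K2 : Rabs (s + k - s0) < eta).
  { revert H0; unfold Rabs; repeat destruct Rcase_abs; lra. }
  assert (Hx' : Rabs (x - x0) < eta) by lra.
  pose proof (implicit_increasing x (s - k) s Hx' K1 H1 ltac:(lra)) as L1.
  pose proof (implicit_increasing x s (s + k) Hx' H1 K2 ltac:(lra)) as L2.
  destruct (implicit_cont_x x (s - k) ((z - F x (s - k)) / 2) Hx' K1 ltac:(lra)) as (e1 & He1 & C1).
  destruct (implicit_cont_x x (s + k) ((F x (s + k) - z) / 2) Hx' K2 ltac:(lra)) as (e2 & He2 & C2).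
  set (m1 := Rmin (Rmin e1 e2) (Rmin (e - Rabs (x - x0)) (e - Rabs (z - F x0 s0)))).
  set (m2 := Rmin ((z - F x (s - k)) / 2) ((F x (s + k) - z) / 2)).
  assert (Hm : 0 < Rmin m1 m2) by (unfold m1, m2; repeat apply Rmin_pos; lra).
  exists (mkposreal _ Hm). intros [x' z'] [Bx Bz].
  change (Rabs (x' - x) < Rmin m1 m2) in Bx. change (Rabs (z' - z) < Rmin m1 m2) in Bz.
  simpl. apply Hd. change (Rabs (S x' z' - s) < d).
  assert (Hm1 : forall t, t < Rmin m1 m2 -> t < e1 /\ t < e2 /\ t < e - Rabs (x - x0)
     /\ t < e - Rabs (z - F x0 s0) /\ t < (z - F x (s - k)) / 2 /\ t < (F x (s + k) - z) / 2).
  { intros t Ht. unfold m1, m2 in Ht.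
    repeat match type of Ht with
    | t < Rmin ?a ?b => pose proof (Rlt_le_trans _ _ _ Ht (Rmin_l a b));
        pose proof (Rlt_le_trans _ _ _ Ht (Rmin_r a b)); clear Ht end.
    repeat match goal with Ht : t < Rmin ?a ?b |- _ =>
        pose proof (Rlt_le_trans _ _ _ Ht (Rmin_l a b));
        pose proof (Rlt_le_trans _ _ _ Ht (Rmin_r a b)); clear Ht end.
    tauto. }
  destruct (Hm1 _ Bx) as (X1 & X2 & X3 & X4 & X5 & X6).
  destruct (Hm1 _ Bz) as (Z1 & Z2 & Z3 & Z4 & Z5 & Z6).
  assert (Tx : Rabs (x' - x0) < e).
  { replace (x' - x0) with ((x' - x) + (x - x0)) by ring.
    eapply Rle_lt_trans; [apply Rabs_triang|lra]. }
  assert (Tz : Rabs (z' - F x0 s0) < e).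
  { replace (z' - F x0 s0) with ((z' - z) + (z - F x0 s0)) by ring.
    eapply Rle_lt_trans; [apply Rabs_triang|lra]. }
  destruct (Hsol x' z' Tx Tz) as [G1 G2]. fold (S x' z') in *.
  specialize (C1 _ X1). specialize (C2 _ X2).
  apply Rabs_lt_iff in C1, C2, Z5, Z6.
  assert (A1 : s - k < S x' z').
  { apply Rnot_le_lt. intro L. destruct L as [L|L].
    - pose proof (implicit_increasing x' _ _ ltac:(lra) G1 K1 L). lra.
    - rewrite L in G2. lra. }
  assert (A2 : S x' z' < s + k).
  { apply Rnot_le_lt. intro L. destruct L as [L|L].
    - pose proof (implicit_increasing x' _ _ ltac:(lra) K2 G1 L). lra.
    - rewrite <- L in G2. lra. }
  apply Rabs_lt_iff; lra.
Qed.

(* Both partial derivatives come from the mean value theorem along the two legs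
   [(x,s) -> (x,s') -> (x',s')]; the difference quotient is then a continuous
   function of the intermediate points. *)
Lemma implicit_increment x s x' s' :
  Rabs (x - x0) < eta -> Rabs (x' - x0) < eta -> Rabs (s - s0) < eta -> Rabs (s' - s0) < eta ->
  exists xi zeta, Rabs (xi - x) <= Rabs (x' - x) /\ Rabs (zeta - s) <= Rabs (s' - s) /\
    F x' s' - F x s = Fx xi s' * (x' - x) + Fs x zeta * (s' - s) /\ 0 < Fs x zeta.
Proof.
  intros Hx Hx' Hs Hs'.
  destruct (MVT_gen (fun x => F x s') x x' (fun x => Fx x s')) as (xi & Hxi & E1).
  { intros y Hy. apply HFx; auto. apply (interval_between x x'); auto; lra. }
  { intros y Hy. apply derivable_continuous_pt. exists (Fx y s'). apply is_derive_Reals.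
    apply HFx; auto. apply (interval_between x x'); auto. }
  destruct (MVT_gen (F x) s s' (Fs x)) as (zt & Hzt & E2).
  { intros y Hy. apply HFs; auto. apply (interval_between s s'); auto; lra. }
  { intros y Hy. apply derivable_continuous_pt. exists (Fs x y). apply is_derive_Reals.
    apply HFs; auto. apply (interval_between s s'); auto. }
  assert (HB : forall a b c, Rmin a b <= c <= Rmax a b -> Rabs (c - a) <= Rabs (b - a)).
  { intros a b c. unfold Rmin, Rmax; destruct (Rle_dec a b);
    unfold Rabs; repeat destruct Rcase_abs; lra. }
  exists xi, zt. repeat split; auto; [lra|].
  apply Hpos; auto. apply (interval_between s s'); auto.
Qed.

Lemma continuous2_ball (f : R -> R -> R) a b d :
  continuous (fun p => f (fst p) (snd p)) (a, b) -> 0 < d ->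
  exists r, 0 < r /\ forall a' b', Rabs (a' - a) < r -> Rabs (b' - b) < r ->
    Rabs (f a' b' - f a b) < d.
Proof.
  intros H Hd.
  destruct (H (ball (f a b) (mkposreal d Hd)) (locally_ball _ _)) as [r Hr].
  exists r; split; [apply cond_pos|]. intros a' b' Ha Hb.
  apply (Hr (a', b')). split; assumption.
Qed.

Lemma continuous_quot_ball a b d : b <> 0 -> 0 < d -> exists r, 0 < r /\
  forall a' b', Rabs (a' - a) < r -> Rabs (b' - b) < r -> Rabs (a' / b' - a / b) < d.
Proof.
  intros Hb Hd. apply (continuous2_ball (fun a b => a / b)); [|exact Hd].
  apply (continuous_mult (fun p : R * R => fst p) (fun p => / snd p)).
  - apply continuous_fst.
  - apply (continuous_comp snd Rinv); [apply continuous_snd|].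
    apply continuity_pt_filterlim, (continuity_pt_inv id); auto.
    apply continuity_pt_id.
Qed.

Lemma is_derive_quotient f x l :
  (forall d, 0 < d -> exists r, 0 < r /\ forall h, h <> 0 -> Rabs h < r ->
     Rabs ((f (x + h) - f x) / h - l) < d) -> is_derive f x l.
Proof.
  intro H. apply is_derive_Reals. intros d Hd. destruct (H d Hd) as (r & Hr & Hh).
  exists (mkposreal r Hr). exact Hh.
Qed.

Lemma implicit_derive_x x z : Rabs (x - x0) < e -> Rabs (z - F x0 s0) < e ->
  is_derive (fun x => S x z) x (- Fx x (S x z) / Fs x (S x z)).
Proof.
  intros Hx Hz. destruct (Hsol x z Hx Hz) as [H1 H2]. fold (S x z) in *.
  set (s := S x z) in *. assert (Hx' : Rabs (x - x0) < eta) by lra.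
  pose proof (Hpos x s Hx' H1) as Hp.
  apply is_derive_quotient. intros d Hd. fold s.
  destruct (continuous_quot_ball (- Fx x s) (Fs x s) d ltac:(lra) Hd) as (r & Hr & Q).
  destruct (continuous2_ball Fx x s r (Hcx x s Hx' H1) Hr) as (r1 & Hr1 & Q1).
  destruct (continuous2_ball Fs x s r (Hcs x s Hx' H1) Hr) as (r2 & Hr2 & Q2).
  (* Continuity of [S], obtained without derivatives, brings s' and therefore the intermediate point
     [zt] close to [s]. *)
  destruct (continuous2_ball S x z (Rmin r1 r2) (implicit_continuous x z Hx Hz)
    ltac:(apply Rmin_pos; lra)) as (r3 & Hr3 & Q3).
  exists (Rmin (e - Rabs (x - x0)) (Rmin r1 r3)).
  split; [repeat apply Rmin_pos; lra|]. intros h Hh Hhr.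
  pose proof (Rmin_l (e - Rabs (x - x0)) (Rmin r1 r3)).
  pose proof (Rmin_r (e - Rabs (x - x0)) (Rmin r1 r3)).
  pose proof (Rmin_l r1 r3). pose proof (Rmin_r r1 r3).
  pose proof (Rmin_l r1 r2). pose proof (Rmin_r r1 r2).
  assert (Eh : x + h - x = h) by ring.
  assert (Tx : Rabs (x + h - x0) < e).
  { replace (x + h - x0) with (h + (x - x0)) by ring.
    eapply Rle_lt_trans; [apply Rabs_triang|lra]. }
  specialize (Q3 (x + h) z ltac:(rewrite Eh; lra) ltac:(rewrite Rminus_diag, Rabs_R0; lra)).
  fold s in Q3.
  destruct (Hsol (x + h) z Tx Hz) as [G1 G2]. fold (S (x + h) z) in *.
  set (s' := S (x + h) z) in *.
  destruct (implicit_increment x s (x + h) s' Hx' ltac:(lra) H1 G1)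
    as (xi & zt & B1 & B2 & E & Hp').
  rewrite Eh in B1, E.
  replace ((s' - s) / h) with (- Fx xi s' / Fs x zt).
  2:{ rewrite G2, H2 in E. apply Rmult_eq_reg_r with (h * Fs x zt).
      2:{ apply Rmult_integral_contrapositive; split; lra. }
      field_simplify; lra. }
  apply Q.
  - replace (- Fx xi s' - - Fx x s) with (- (Fx xi s' - Fx x s)) by ring.
    rewrite Rabs_Ropp. apply Q1; lra.
  - apply Q2; [rewrite Rminus_diag, Rabs_R0; lra|lra].
Qed.

Lemma implicit_derive_z x z : Rabs (x - x0) < e -> Rabs (z - F x0 s0) < e ->
  is_derive (fun z => S x z) z (/ Fs x (S x z)).
Proof.
  intros Hx Hz. destruct (Hsol x z Hx Hz) as [H1 H2]. fold (S x z) in *.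
  set (s := S x z) in *. assert (Hx' : Rabs (x - x0) < eta) by lra.
  pose proof (Hpos x s Hx' H1) as Hp.
  apply is_derive_quotient. intros d Hd. fold s.
  destruct (continuous_quot_ball 1 (Fs x s) d ltac:(lra) Hd) as (r & Hr & Q).
  destruct (continuous2_ball Fs x s r (Hcs x s Hx' H1) Hr) as (r2 & Hr2 & Q2).
  destruct (continuous2_ball S x z r2 (implicit_continuous x z Hx Hz) Hr2) as (r3 & Hr3 & Q3).
  exists (Rmin (e - Rabs (z - F x0 s0)) r3).
  split; [repeat apply Rmin_pos; lra|]. intros h Hh Hhr.
  pose proof (Rmin_l (e - Rabs (z - F x0 s0)) r3).
  pose proof (Rmin_r (e - Rabs (z - F x0 s0)) r3).
  assert (Eh : z + h - z = h) by ring.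
  assert (Tz : Rabs (z + h - F x0 s0) < e).
  { replace (z + h - F x0 s0) with (h + (z - F x0 s0)) by ring.
    eapply Rle_lt_trans; [apply Rabs_triang|lra]. }
  specialize (Q3 x (z + h) ltac:(rewrite Rminus_diag, Rabs_R0; lra) ltac:(rewrite Eh; lra)).
  fold s in Q3.
  destruct (Hsol x (z + h) Hx Tz) as [G1 G2]. fold (S x (z + h)) in *.
  set (s' := S x (z + h)) in *.
  destruct (implicit_increment x s x s' Hx' Hx' H1 G1)
    as (xi & zt & B1 & B2 & E & Hp').
  replace ((s' - s) / h) with (1 / Fs x zt).
  2:{ rewrite G2, H2 in E. apply Rmult_eq_reg_r with (h * Fs x zt).
      2:{ apply Rmult_integral_contrapositive; split; lra. }
      field_simplify; lra. }
  replace (/ Fs x s) with (1 / Fs x s) by (unfold Rdiv; ring).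
  apply Q.
  - rewrite Rminus_diag, Rabs_R0; lra.
  - apply Q2; [rewrite Rminus_diag, Rabs_R0; lra|lra].
Qed.

End ImplicitFunction.

(** * The Legendre transform *)

(** [Fstar] is the larger root of this quadratic, which the first bound records. Dividing by F rho
    gives 1/rho + t = a for the covector scaled to [Fstar] = 1, and the bound becomes s >= a/2. The
    discriminant is nonnegative on the whole fibre because t <= x rho and 4 x <= a^2. *)
Lemma Fstar_quadratic c x y r t : 0 < x -> 4 * x <= (x ^ 2 / 2 + c) ^ 2 -> 0 < x ^ 2 / 2 + c ->
  0 < r ^ 2 + t ^ 2 / x ^ 2 ->
  let a := x ^ 2 / 2 + c in let rho := sqrt (r ^ 2 + t ^ 2 / x ^ 2) in
  let F := Fstar c x y r t in
  a * rho / 2 <= F /\ F ^ 2 - a * rho * F + t * rho = 0.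
Proof.
  intros Hx Ha2 Ha Hrho. unfold Fstar.
  set (a := x ^ 2 / 2 + c) in *. set (rho := sqrt (r ^ 2 + t ^ 2 / x ^ 2)).
  cbv zeta. replace (x ^ 2 + 2 * c) with (2 * a) by (unfold a; field).
  assert (Hr : 0 < rho) by now apply sqrt_lt_R0.
  assert (Hr2 : rho ^ 2 = r ^ 2 + t ^ 2 / x ^ 2) by (apply pow2_sqrt; lra).
  assert (Ht : t <= x * rho).
  { apply Rnot_lt_le; intro L.
    assert (E : t ^ 2 = x ^ 2 * (rho ^ 2 - r ^ 2)) by (rewrite Hr2; field; lra).
    assert (0 < x * rho) by nra.
    assert ((x * rho) ^ 2 < t ^ 2) by nra.
    pose proof (pow2_ge_0 (x * r)). nra. }
  assert (Hq : 0 <= 1 - 16 * t / (rho * (2 * a) ^ 2)).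
  { apply Rmult_le_reg_r with (rho * (2 * a) ^ 2); [nra|].
    replace ((1 - 16 * t / (rho * (2 * a) ^ 2)) * (rho * (2 * a) ^ 2))
      with (4 * (rho * a ^ 2 - 4 * t)) by (field; lra). nra. }
  set (q := sqrt (1 - 16 * t / (rho * (2 * a) ^ 2))).
  assert (Hq0 : 0 <= q) by apply sqrt_pos.
  assert (Hq2 : q ^ 2 = 1 - 16 * t / (rho * (2 * a) ^ 2)) by now apply pow2_sqrt.
  assert (0 <= a * rho * q) by (apply Rmult_le_pos; [nra|assumption]).
  split; [lra|].
  replace ((/ 4 * (2 * a) * rho * (1 + q)) ^ 2
             - a * rho * (/ 4 * (2 * a) * rho * (1 + q)) + t * rho)
    with (a ^ 2 * rho ^ 2 * (q ^ 2 - 1) / 4 + t * rho) by field.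
  rewrite Hq2. field. lra.
Qed.

(** On the curve the inner square root is (s - t)/(s + t) up to sign; t < s fixes the sign and thus
    the branch. The factor [l] carries the homogeneity. *)
Lemma Fstar_on_curve c x y r t s l : 0 < x -> 0 < s -> 0 < l -> t < s ->
  s + t = x ^ 2 / 2 + c -> 0 < x ^ 2 / 2 + c -> r ^ 2 + t ^ 2 / x ^ 2 = / s ^ 2 ->
  Fstar c x y (l * r) (l * t) = l.
Proof.
  intros Hx Hs Hl Hts Hst Ha Hr. unfold Fstar.
  replace ((l * r) ^ 2 + (l * t) ^ 2 / x ^ 2) with ((l / s) ^ 2).
  2:{ replace ((l / s) ^ 2) with (l ^ 2 * / s ^ 2) by (field; lra). rewrite <- Hr. field; lra. }
  rewrite sqrt_pow2 by (apply Rlt_le, Rdiv_lt_0_compat; assumption).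
  cbv zeta. replace (x ^ 2 + 2 * c) with (2 * (s + t)) by lra.
  assert (Hpos : 0 < s + t) by lra.
  replace (1 - 16 * (l * t) / (l / s * (2 * (s + t)) ^ 2)) with (((s - t) / (s + t)) ^ 2)
    by (field; lra).
  rewrite sqrt_pow2.
  - field; lra.
  - apply Rlt_le, Rdiv_lt_0_compat; lra.
Qed.

(* With [1/rho] and the angle as coordinates on the curve, the claim reads
   [1 - cos alpha >= (1 - s1/s0)^2], and [1 - cos alpha] dominates half of the squared
   difference of the sines [s t / x], which factors through [s0 - s1]. *)
Lemma curve_supporting_line x a m w r0 t0 s0 r1 t1 s1 : 0 < x -> 0 < s0 -> 0 < s1 ->
  s0 + t0 = a -> s1 + t1 = a ->
  r0 ^ 2 + t0 ^ 2 / x ^ 2 = / s0 ^ 2 -> r1 ^ 2 + t1 ^ 2 / x ^ 2 = / s1 ^ 2 ->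
  a / 2 <= s1 -> a / 2 <= m -> x < m * (a - m) ->
  0 < s0 + m - a -> 2 * x ^ 2 <= s0 ^ 2 * (s0 + m - a) ^ 2 ->
  0 < t0 / x ^ 2 - / s0 ^ 3 -> w * (t0 / x ^ 2 - / s0 ^ 3) = r0 ->
  r1 * w + t1 <= r0 * w + t0.
Proof.
  intros Hx Hs0 Hs1 E0 E1 C0 C1 Hs1a Hma Hm Hpos Hbd Hk Hw.
  set (k := t0 / x ^ 2 - / s0 ^ 3) in *.
  set (al0 := s0 * r0). set (al1 := s1 * r1).
  set (be0 := s0 * t0 / x). set (be1 := s1 * t1 / x).
  assert (N0 : al0 ^ 2 + be0 ^ 2 = 1).
  { replace (al0 ^ 2 + be0 ^ 2) with (s0 ^ 2 * (r0 ^ 2 + t0 ^ 2 / x ^ 2))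
      by (unfold al0, be0; field; lra). rewrite C0; field; lra. }
  assert (N1 : al1 ^ 2 + be1 ^ 2 = 1).
  { replace (al1 ^ 2 + be1 ^ 2) with (s1 ^ 2 * (r1 ^ 2 + t1 ^ 2 / x ^ 2))
      by (unfold al1, be1; field; lra). rewrite C1; field; lra. }
  (* The sine [be1] is at most 1, so s1 (a - s1) <= x < m (a - m), and s (a - s) decreases for s >=
     a/2. Thus [m] bounds the whole competing curve from below. *)
  assert (Hsm : m <= s1).
  { apply Rnot_lt_le; intro L.
    assert (Hb : be1 <= 1) by nra.
    assert (E : s1 * t1 = be1 * x) by (unfold be1; field; lra).
    assert (x < s1 * t1) by (replace t1 with (a - s1) by lra; nra). nra. }
  assert (Hbe : be0 - be1 = (s1 - s0) * (s0 + s1 - a) / x).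
  { unfold be0, be1. replace t0 with (a - s0) by lra. replace t1 with (a - s1) by lra.
    field; lra. }
  assert (Hdot : al0 * al1 + be0 * be1 <= 1 - (s1 - s0) ^ 2 / s0 ^ 2).
  { assert (H1 : al0 * al1 + be0 * be1 <= 1 - (be0 - be1) ^ 2 / 2)
      by (pose proof (pow2_ge_0 (al0 - al1)); clear - N0 N1 H; nra).
    assert (H2 : 2 * ((s1 - s0) ^ 2 / s0 ^ 2) <= (be0 - be1) ^ 2).
    { rewrite Hbe. apply Rmult_le_reg_r with (s0 ^ 2 * x ^ 2); [apply Rmult_lt_0_compat; nra|].
      replace (2 * ((s1 - s0) ^ 2 / s0 ^ 2) * (s0 ^ 2 * x ^ 2))
        with ((s1 - s0) ^ 2 * (2 * x ^ 2)) by (field; lra).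
      replace (((s1 - s0) * (s0 + s1 - a) / x) ^ 2 * (s0 ^ 2 * x ^ 2))
        with ((s1 - s0) ^ 2 * (s0 ^ 2 * (s0 + s1 - a) ^ 2)) by (field; lra).
      apply Rmult_le_compat_l; [apply pow2_ge_0|].
      eapply Rle_trans; [exact Hbd|]. apply Rmult_le_compat_l; [apply pow2_ge_0|].
      apply pow_incr; lra. }
    lra. }
  (* Since k (w, 1) = (r0, k) is a multiple of the gradient of 1/rho + t at (r0, t0), the line being
     tested is the tangent. The positive factor [k] removes the division in [w]. *)
  assert (Hfin : k * ((r1 * w + t1) - (r0 * w + t0)) <= 0).
  { replace (k * (r1 * w + t1 - (r0 * w + t0))) with (r0 * (r1 - r0) + k * (t1 - t0)).
    2:{ rewrite <- Hw. ring. }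
    replace (r0 * (r1 - r0) + k * (t1 - t0)) with
      ((al0 * al1 + be0 * be1) / (s0 * s1) - (r0 ^ 2 + t0 ^ 2 / x ^ 2) - (s0 - s1) / s0 ^ 3).
    2:{ unfold k, al0, al1, be0, be1. replace s1 with (s0 + t0 - t1) by lra. field; lra. }
    rewrite C0.
    replace ((al0 * al1 + be0 * be1) / (s0 * s1) - / s0 ^ 2 - (s0 - s1) / s0 ^ 3)
      with ((al0 * al1 + be0 * be1 - (1 - (s1 - s0) ^ 2 / s0 ^ 2)) * / (s0 * s1))
      by (field; lra).
    assert (0 < / (s0 * s1)) by (apply Rinv_0_lt_compat; nra). nra. }
  apply Rnot_lt_le; intro L.
  pose proof (Rmult_lt_0_compat _ _ Hk (proj2 (Rlt_0_minus _ _) L)). lra.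
Qed.

Lemma supR_unique P l : is_lub P l -> supR P = l.
Proof.
  intro H. apply (is_lub_u P); [|exact H].
  apply (epsilon_spec (inhabits 0) (fun l => is_lub P l)). now exists l.
Qed.

(** By homogeneity only the support function of the curve [Fstar] = 1 in the direction (w, 1)
    matters; its value is f = r0 w + t. Maximizing F v f - F^2/2 over the scale F then gives (v
    f)^2/2, attained at F = v f. The hypotheses on [m] feed the global inequality of
    [curve_supporting_line]. *)
Lemma Lag_formula c x y u v s m : 0 < x -> 0 < v -> 0 < s ->
  let a := x ^ 2 / 2 + c in let t := a - s in
  0 < a -> 4 * x <= a ^ 2 -> t < s -> 0 < s ^ 3 * t - x ^ 2 ->
  (x ^ 2 - (s * t) ^ 2) * x ^ 2 * s ^ 4 / (s ^ 3 * t - x ^ 2) ^ 2 = u ^ 2 / v ^ 2 ->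
  a / 2 <= m -> x < m * (a - m) -> 0 < s + m - a ->
  2 * x ^ 2 <= s ^ 2 * (s + m - a) ^ 2 ->
  Lag c x y u v = / 2 * (v ^ 2 * (x ^ 2 * (s - t) / (s ^ 3 * t - x ^ 2)) ^ 2).
Proof.
  intros Hx Hv Hs a t Ha Ha2 Hts Hk HZ Hm1 Hm2 Hm3 Hm4.
  set (d := s ^ 3 * t - x ^ 2) in *.
  set (w := u / v). set (k := t / x ^ 2 - / s ^ 3).
  assert (Ek : k = d / (x ^ 2 * s ^ 3)) by (unfold k, d; field; lra).
  assert (Hx2s : 0 < x ^ 2 * s ^ 3) by (apply Rmult_lt_0_compat; apply pow_lt; assumption).
  assert (Hkpos : 0 < k) by (rewrite Ek; apply Rdiv_lt_0_compat; assumption).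
  set (r0 := w * k).
  assert (Hw2 : w ^ 2 = (x ^ 2 - (s * t) ^ 2) * x ^ 2 * s ^ 4 / d ^ 2).
  { rewrite HZ. unfold w. field. lra. }
  assert (C0 : r0 ^ 2 + t ^ 2 / x ^ 2 = / s ^ 2).
  { unfold r0. replace ((w * k) ^ 2) with (w ^ 2 * k ^ 2) by ring. rewrite Hw2, Ek. field. lra. }
  set (f := x ^ 2 * (s - t) / d).
  assert (Ef : r0 * w + t = f).
  { replace (r0 * w) with (w ^ 2 * k) by (unfold r0; ring).
    replace (w ^ 2 * k) with ((x ^ 2 - (s * t) ^ 2) * s / d) by (rewrite Hw2, Ek; field; lra).
    apply Rmult_eq_reg_r with d; [|lra].
    replace (((x ^ 2 - (s * t) ^ 2) * s / d + t) * d) with ((x ^ 2 - (s * t) ^ 2) * s + t * d)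
      by (field; lra).
    replace (f * d) with (x ^ 2 * (s - t)) by (unfold f; field; lra).
    unfold d; ring. }
  assert (Hf : 0 < f).
  { apply Rdiv_lt_0_compat; [apply Rmult_lt_0_compat; [apply pow_lt|]; lra|assumption]. }
  apply supR_unique. split.
  - intros z (r1 & t1 & ->). unfold Lstar.
    destruct (Rle_lt_dec (r1 ^ 2 + t1 ^ 2 / x ^ 2) 0) as [H0|H0].
    (* Only the zero covector falls here; it cannot be scaled onto the curve, but its contribution
       is at most 0. *)
    + assert (Q1 : 0 <= t1 ^ 2 / x ^ 2).
      { apply Rmult_le_pos; [apply pow2_ge_0|]. apply Rlt_le, Rinv_0_lt_compat, pow_lt, Hx. }
      assert (r1 = 0) by nra.
      assert (Q2 : t1 ^ 2 / x ^ 2 = 0) by nra.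
      assert (Q3 : t1 ^ 2 = 0).
      { replace (t1 ^ 2) with (t1 ^ 2 / x ^ 2 * x ^ 2) by (field; lra). rewrite Q2; ring. }
      assert (t1 = 0) by nra. subst.
      pose proof (pow2_ge_0 (Fstar c x y 0 0)). pose proof (pow2_ge_0 (v * f)).
      replace (v ^ 2 * f ^ 2) with ((v * f) ^ 2) by ring. lra.
    + destruct (Fstar_quadratic c x y r1 t1 Hx Ha2 Ha H0) as [Q1 Q2].
      fold a in Q1, Q2.
      set (F := Fstar c x y r1 t1) in *. set (rho := sqrt (r1 ^ 2 + t1 ^ 2 / x ^ 2)) in *.
      assert (Hr : 0 < rho) by now apply sqrt_lt_R0.
      assert (Hr2 : rho ^ 2 = r1 ^ 2 + t1 ^ 2 / x ^ 2) by (apply pow2_sqrt; lra).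
      assert (HF : 0 < F) by (assert (0 < a * rho) by nra; lra).
      assert (HL : r1 / F * w + t1 / F <= r0 * w + t).
      { apply (curve_supporting_line x a m w r0 t s (r1 / F) (t1 / F) (F / rho)); auto.
        - apply Rdiv_lt_0_compat; assumption.
        - unfold t; ring.
        - apply Rmult_eq_reg_r with (F * rho); [|nra].
          replace ((F / rho + t1 / F) * (F * rho)) with (F ^ 2 + t1 * rho) by (field; lra). lra.
        - replace ((r1 / F) ^ 2 + (t1 / F) ^ 2 / x ^ 2) with ((r1 ^ 2 + t1 ^ 2 / x ^ 2) / F ^ 2)
            by (field; lra).
          rewrite <- Hr2. field. lra.
        - apply Rmult_le_reg_r with rho; [assumption|].
          replace (F / rho * rho) with F by (field; lra). lra. }
      rewrite Ef in HL.
      assert (HL' : r1 * u + t1 * v <= F * v * f).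
      { replace (r1 * u + t1 * v) with (F * v * (r1 / F * w + t1 / F)) by (unfold w; field; lra).
        apply Rmult_le_compat_l; [nra|exact HL]. }
      (* The square (F - v f)^2 >= 0 turns F v f - F^2/2 into at most (v f)^2/2. *)
      pose proof (pow2_ge_0 (F - v * f)). nra.
  - intros b Hb. apply Hb. exists (v * f * r0), (v * f * t). unfold Lstar.
    rewrite (Fstar_on_curve c x y r0 t s (v * f)); auto.
    + replace (v * f * r0 * u + v * f * t * v) with (v ^ 2 * f * (r0 * w + t))
        by (unfold w; field; lra).
      rewrite Ef. field.
    + nra.
    + unfold t; fold a; ring.
Qed.

(** * The curvature at the base point *)

(* The curve [F* = 1] in the fibre over [x] is parametrized by [s = 1/rho], so that
   [t = a - s] with [a = x^2/2 + c]. At the parameter [s] the Legendre transform takes the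
   direction [(u, v)] with [(u/v)^2 = eZ] and the value [F = v eF]; both are rational in
   [(x, s)], with common denominator [eD] up to powers. *)
Inductive xs := vx | vs.

Definition eX : expr xs := Var vx.
Definition eS : expr xs := Var vs.
Definition eA : expr xs := Add (Mul (Cst (1 # 2)) (Mul eX eX)) (Cst (199 # 128)).
Definition eT : expr xs := ssub eA eS.
Definition eD : expr xs := ssub (Mul eS (Mul eS (Mul eS eT))) (Mul eX eX).
(** Up to sign, u/v is [eW] times the square root of x^2 - (s t)^2. *)
Definition eW : expr xs := Mul (Mul eX (Mul eS eS)) (Inv eD).
Definition eST : expr xs := Mul eS eT.
Definition eZ : expr xs := Mul (Mul (ssub eX eST) (Add eX eST)) (Mul eW eW).
Definition eF : expr xs := Mul (Mul (Mul eX eX) (ssub eS eT)) (Inv eD).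

Definition env_free (t : xs) : fn4 :=
  match t with vx => fun a _ _ _ => a | vs => fun _ _ c _ => c end.
Definition dv_free (i : nat) (t : xs) : expr xs :=
  match i, t with 0%nat, vx | 2%nat, vs => Cst 1 | _, _ => Cst 0 end.

Definition eZx : expr xs := deriv (dv_free 0) eZ.
Definition eZs : expr xs := deriv (dv_free 2) eZ.
Definition base_xs (t : xs) : option Q := match t with vx => Some (5 # 8) | vs => Some (5 # 4) end.

(* [S] stands for the inverse function of the ratio [eZ] in [s], a function of [x] and
   [z = (u/v)^2]; the latter sits in the third coordinate. *)
Definition env_sol (S : R -> R -> R) (t : xs) : fn4 :=
  match t with vx => fun a _ _ _ => a | vs => fun a _ c _ => S a c end.
(** Implicit differentiation of Z(x, S(x, z)) = z, where Z is the function denoted by [eZ]. *)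
Definition dv_sol (i : nat) (t : xs) : expr xs :=
  match i, t with
  | 0%nat, vx => Cst 1
  | 0%nat, vs => sopp (smul eZx (Inv eZs))
  | 2%nat, vs => Inv eZs
  | _, _ => Cst 0
  end.
(* In a word, [true] is a derivative in [x] and [false] one in [z]. *)
Fixpoint word_expr (w : list bool) : expr xs :=
  match w with
  | [] => eF
  | true :: w => deriv (dv_sol 0) (word_expr w)
  | false :: w => deriv (dv_sol 2) (word_expr w)
  end.

(* Keeping the [x]- and [z]-derivatives of [F/v] as atoms [at_ w] keeps the fourth
   derivatives of the Lagrangian small enough to compute with. *)
Inductive atom := ax | au | av | at_ (w : list bool).
Definition aU : expr atom := Var au.
Definition aV : expr atom := Var av.
(** The chain rule through z = u^2/v^2. Derivatives in [y] vanish by rotational symmetry. *)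
Definition dv_atom (i : nat) (t : atom) : expr atom :=
  match i, t with
  | 0%nat, ax | 2%nat, au | 3%nat, av => Cst 1
  | 0%nat, at_ w => Var (at_ (true :: w))
  | 2%nat, at_ w => Mul (Mul (Mul (Cst 2) aU) (Mul (Inv aV) (Inv aV))) (Var (at_ (false :: w)))
  | 3%nat, at_ w => Mul (Mul (Mul (Cst (-2)) (Mul aU aU)) (Mul (Inv aV) (Mul (Inv aV) (Inv aV))))
      (Var (at_ (false :: w)))
  | _, _ => Cst 0
  end.
Definition dif (i : nat) (e : expr atom) := deriv (dv_atom i) e.
Definition eL : expr atom :=
  Mul (Cst (1 # 2)) (Mul (Mul aV aV) (Mul (Var (at_ [])) (Var (at_ [])))).
Definition eDm : expr atom :=
  ssub (smul (dif 2 (dif 2 eL)) (dif 3 (dif 3 eL))) (smul (dif 3 (dif 2 eL)) (dif 3 (dif 2 eL))).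
Definition eG : expr atom :=
  smul (Mul (Cst (1 # 2)) (Inv eDm))
  (sadd (ssub (ssub (smul (dif 3 (dif 3 eL)) (dif 0 eL)) (smul (dif 0 (dif 3 eL)) (dif 3 eL)))
   (smul (dif 3 (dif 2 eL)) (dif 1 eL))) (smul (dif 1 (dif 2 eL)) (dif 3 eL))).
Definition eH : expr atom :=
  smul (Mul (Cst (1 # 2)) (Inv eDm))
  (sadd (ssub (ssub (smul (dif 2 (dif 2 eL)) (dif 1 eL)) (smul (dif 1 (dif 2 eL)) (dif 2 eL)))
   (smul (dif 2 (dif 3 eL)) (dif 0 eL))) (smul (dif 0 (dif 3 eL)) (dif 2 eL))).
(** Keeping the entries abstract lets the denotation be expanded once, without unfolding the large
    expressions substituted later. *)
Definition curvature_expr (v Lv g gxv gyu guu guv gu gv h hu : expr atom) : expr atom :=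
  smul (ssub (ssub (sadd (sadd (smul (ssub gxv gyu) v) (smul (smul (Cst 2) g) guu))
    (smul (smul (Cst 2) h) guv)) (smul gu gu)) (smul gv hu)) (Inv (smul v Lv)).
Definition eK : expr atom :=
  curvature_expr aV (dif 3 eL) eG (dif 3 (dif 0 eG)) (dif 2 (dif 1 eG)) (dif 2 (dif 2 eG))
    (dif 3 (dif 2 eG)) (dif 2 eG) (dif 3 eG) eH (dif 2 eH).
(* Values at [(5/8, 0, 0, 1)]. Derivatives of order three or more are left unknown: in the
   curvature they are multiplied by [u = 0]. *)
Definition base_atom (t : atom) : option Q :=
  match t with
  | ax => Some (5 # 8) | au => Some 0%Q | av => Some 1%Q
  | at_ [] => Some (1 # 2)
  | at_ [true] => Some (11 # 12)
  | at_ [false] => Some (48 # 125)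
  | at_ [true; true] => Some (5 # 108)
  | at_ [true; false] | at_ [false; true] => Some (-1976 # 1875)
  | at_ [false; false] => Some (-19968 # 78125)
  | _ => None
  end%Q.

Lemma den_curvature_expr env v Lv g gxv gyu guu guv gu gv h hu x y u w :
  let d e := den env e x y u w in
  den env (curvature_expr v Lv g gxv gyu guu guv gu gv h hu) x y u w =
  ((d gxv - d gyu) * d v + 2 * d g * d guu + 2 * d h * d guv - d gu * d gu - d gv * d hu)
  / (d v * d Lv).
Proof.
  cbv zeta. unfold curvature_expr.
  rewrite den_smul, !den_ssub, !den_sadd, !den_smul, den_ssub. cbn [den]. rewrite den_smul.
  replace (Q2R 2) with 2 by (unfold Q2R; simpl; lra). reflexivity.
Qed.

Lemma eK_value : evalQ base_atom eK = Some (-25 # 6)%Q.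
Proof. vm_compute. reflexivity. Qed.

Notation xb := (5 / 8). Notation sb := (5 / 4).

Lemma differential_free U : differential xs env_free dv_free U.
Proof.
  split.
  - intros i t Hi. destruct i as [|[|[|i]]], t; exact I.
  - intros i t a b c d Hi _.
    destruct i as [|[|[|i]]], t; simpl; rewrite ?Q2R_0, ?Q2R_1;
      first [apply @is_derive_const | apply @is_derive_id].
Qed.

Lemma cont4_free t a b c d : cont4 (env_free t) a b c d.
Proof.
  destruct t; unfold cont4, unc; simpl.
  - apply continuous_fst.
  - apply (continuous_comp snd (fun q : R * (R * R) => fst (snd q))); [apply continuous_snd|].
    apply (continuous_comp snd fst); [apply continuous_snd|apply continuous_fst].
Qed.

Lemma base_free t q : base_xs t = Some q -> env_free t xb 0 sb 0 = Q2R q.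
Proof. destruct t; simpl; intros [= <-]; unfold Q2R; simpl; lra. Qed.

Definition ratio (x s : R) := den env_free eZ x 0 s 0.
Definition ratio_dx (x s : R) := den env_free eZx x 0 s 0.
Definition ratio_ds (x s : R) := den env_free eZs x 0 s 0.

Lemma wf_eD U : wf env_free U eD.
Proof. simpl; repeat split; auto. Qed.

Lemma wf_eZ U : (forall a b c d, U a b c d -> den env_free eD a b c d <> 0) -> wf env_free U eZ.
Proof. intro H; simpl; repeat split; auto. Qed.

Lemma wf_eF U : (forall a b c d, U a b c d -> den env_free eD a b c d <> 0) -> wf env_free U eF.
Proof. intro H; simpl; repeat split; auto. Qed.

Lemma wf_dv_free U i t : wf env_free U (dv_free i t).
Proof. destruct i as [|[|[|i]]], t; exact I. Qed.

(** [eD] is the common denominator, and positivity of [eZs] is the monotonicity needed by the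
    implicit function theorem. The bound 1/1000 serves the numerical inequalities of [Lag_atoms]. *)
Lemma positivity_region : exists eta, 0 < eta <= 1 / 1000 /\
  forall a b c d, box eta xb 0 sb 0 a b c d ->
    0 < den env_free eD a b c d /\ 0 < den env_free eZs a b c d.
Proof.
  destruct (cont4_pos (den env_free eD) xb 0 sb 0) as (e1 & He1 & H1).
  { apply (cont4_den env_free (fun _ _ _ _ => True)); auto using wf_eD.
    intros; apply cont4_free. }
  { rewrite (evalQ_correct env_free (fun _ _ _ _ => True) base_xs eD _ _ _ _ (75 # 128)%Q I);
      [unfold Q2R; simpl; lra|apply base_free|reflexivity]. }
  set (U := box e1 xb 0 sb 0).
  assert (HU : U xb 0 sb 0) by now apply box_center.
  (* [eZs] contains inverses of [eD], so its continuity is established only on the box where [eD] is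
     already positive. *)
  destruct (cont4_pos (den env_free eZs) xb 0 sb 0) as (e2 & He2 & H2).
  { apply (cont4_den env_free U); auto.
    - intros; apply cont4_free.
    - apply wf_deriv; [intro; apply wf_dv_free|apply wf_eZ].
      intros a b c d Hp. apply Rgt_not_eq, H1, Hp. }
  { rewrite (evalQ_correct env_free U base_xs eZs _ _ _ _ (125 # 48)%Q HU);
      [unfold Q2R; simpl; lra|apply base_free|vm_compute; reflexivity]. }
  pose proof (Rmin_l (Rmin e1 e2) (1 / 1000)). pose proof (Rmin_r (Rmin e1 e2) (1 / 1000)).
  pose proof (Rmin_l e1 e2). pose proof (Rmin_r e1 e2).
  exists (Rmin (Rmin e1 e2) (1 / 1000)). split.
  { split; [repeat apply Rmin_pos|]; lra. }
  intros a b c d Hp. split.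
  - apply H1. eapply box_mono; [|exact Hp]; lra.
  - apply H2. eapply box_mono; [|exact Hp]; lra.
Qed.

(** * Local inverse of the squared slope *)

Section RatioInverse.

Variable eta : R.
Hypothesis Heta : 0 < eta <= 1 / 1000.
Hypothesis Hreg : forall a b c d, box eta xb 0 sb 0 a b c d ->
    0 < den env_free eD a b c d /\ 0 < den env_free eZs a b c d.

Let U0 := box eta xb 0 sb 0.

Lemma U0_intro x s : Rabs (x - xb) < eta -> Rabs (s - sb) < eta -> U0 x 0 s 0.
Proof. intros H1 H2; repeat split; auto; rewrite Rminus_diag, Rabs_R0; lra. Qed.

Lemma wf_ratio : wf env_free U0 eZ.
Proof. apply wf_eZ. intros a b c d Hp. apply Rgt_not_eq, Hreg, Hp. Qed.

Lemma wf_ratio_dx : wf env_free U0 eZx.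
Proof. apply wf_deriv; [intro; apply wf_dv_free|apply wf_ratio]. Qed.

Lemma wf_ratio_ds : wf env_free U0 eZs.
Proof. apply wf_deriv; [intro; apply wf_dv_free|apply wf_ratio]. Qed.

Lemma cont2_free e x s : wf env_free U0 e -> Rabs (x - xb) < eta -> Rabs (s - sb) < eta ->
  continuous (fun p => den env_free e (fst p) 0 (snd p) 0) (x, s).
Proof.
  intros Hw Hx Hs.
  apply (continuous_comp (fun p : R * R => (fst p, (0, (snd p, 0)))) (unc (den env_free e))).
  - repeat apply continuous_pair;
      first [apply continuous_fst|apply continuous_snd|apply continuous_const].
  - apply (cont4_den env_free U0); auto using U0_intro. intros; apply cont4_free.
Qed.

Lemma ratio_derive_x x s : Rabs (x - xb) < eta -> Rabs (s - sb) < eta ->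
  is_derive (fun x => ratio x s) x (ratio_dx x s).
Proof.
  intros Hx Hs.
  apply (den_deriv xs env_free dv_free U0 (differential_free U0) 0 eZ x 0 s 0);
    auto using U0_intro, wf_ratio.
Qed.

Lemma ratio_derive_s x s : Rabs (x - xb) < eta -> Rabs (s - sb) < eta ->
  is_derive (fun s => ratio x s) s (ratio_ds x s).
Proof.
  intros Hx Hs.
  apply (den_deriv xs env_free dv_free U0 (differential_free U0) 2 eZ x 0 s 0);
    auto using U0_intro, wf_ratio.
Qed.

Lemma ratio_base : ratio xb sb = 0.
Proof.
  unfold ratio. rewrite (evalQ_correct env_free U0 base_xs eZ _ _ _ _ 0%Q).
  - apply Q2R_0.
  - apply U0_intro; rewrite Rminus_diag, Rabs_R0; lra.
  - apply base_free.
  - vm_compute; reflexivity.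
Qed.

(** The inverse exists on both sides of z = 0, although a tangent direction only gives z >= 0;
    two-sided derivatives at z = 0, the value at u = 0, are thereby available. *)
Lemma ratio_inverse : exists S e, 0 < e /\ S xb 0 = sb /\
  forall x z, Rabs (x - xb) < e -> Rabs z < e ->
    Rabs (x - xb) < eta /\
    Rabs (S x z - sb) < eta /\ ratio x (S x z) = z /\
    continuous (fun p => S (fst p) (snd p)) (x, z) /\
    is_derive (fun x => S x z) x (- ratio_dx x (S x z) / ratio_ds x (S x z)) /\
    is_derive (fun z => S x z) z (/ ratio_ds x (S x z)).
Proof.
  assert (Hp : 0 < eta) by lra.
  assert (HP : forall x s, Rabs (x - xb) < eta -> Rabs (s - sb) < eta -> 0 < ratio_ds x s)
    by (intros x s Hx Hs; apply Hreg, U0_intro; assumption).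
  assert (Cx : forall x s, Rabs (x - xb) < eta -> Rabs (s - sb) < eta ->
     continuous (fun p => ratio_dx (fst p) (snd p)) (x, s)).
  { intros x s Hx Hs. apply (cont2_free eZx); [exact wf_ratio_dx|assumption|assumption]. }
  assert (Cs : forall x s, Rabs (x - xb) < eta -> Rabs (s - sb) < eta ->
     continuous (fun p => ratio_ds (fst p) (snd p)) (x, s)).
  { intros x s Hx Hs. apply (cont2_free eZs); [exact wf_ratio_ds|assumption|assumption]. }
  destruct (implicit_exists ratio ratio_dx ratio_ds xb sb eta Hp ratio_derive_x ratio_derive_s HP)
    as (e & He & Hle & Hs).
  exists (implicit_fun ratio sb eta), e.
  assert (Hee : 0 < e <= eta) by lra.
  pose proof (implicit_unique ratio ratio_ds xb sb eta ratio_derive_s HP e Hee Hs) as Hu.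
  pose proof (implicit_continuous ratio ratio_dx ratio_ds xb sb eta Hp
    ratio_derive_x ratio_derive_s HP e Hee Hs) as Hc.
  pose proof (implicit_derive_x ratio ratio_dx ratio_ds xb sb eta Hp
    ratio_derive_x ratio_derive_s HP Cx Cs e Hee Hs) as Hdx.
  pose proof (implicit_derive_z ratio ratio_dx ratio_ds xb sb eta Hp
    ratio_derive_x ratio_derive_s HP Cs e Hee Hs) as Hdz.
  rewrite ratio_base in *. split; [assumption|]. split.
  { apply Hu; rewrite ?Rminus_diag, ?Rabs_R0; auto. apply ratio_base. }
  intros x z Hx Hz. replace z with (z - 0) in Hz by ring.
  destruct (Hs x z Hx Hz) as [H1 H2].
  split; [lra|]. split; [assumption|]. split; [assumption|].
  split; [now apply Hc|]. split; [now apply Hdx|now apply Hdz].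
Qed.

End RatioInverse.

(** * The Lagrangian near the base point in terms of differentiable atoms *)

Section Atoms.

Variables (eta : R) (S : R -> R -> R) (e : R).
Hypothesis Heta : 0 < eta <= 1 / 1000.
Hypothesis Hreg : forall a b c d, box eta xb 0 sb 0 a b c d ->
    0 < den env_free eD a b c d /\ 0 < den env_free eZs a b c d.
Hypothesis He : 0 < e.
Hypothesis HS0 : S xb 0 = sb.
Hypothesis HS : forall x z, Rabs (x - xb) < e -> Rabs z < e ->
    Rabs (x - xb) < eta /\
    Rabs (S x z - sb) < eta /\ ratio x (S x z) = z /\
    continuous (fun p => S (fst p) (snd p)) (x, z) /\
    is_derive (fun x => S x z) x (- ratio_dx x (S x z) / ratio_ds x (S x z)) /\
    is_derive (fun z => S x z) z (/ ratio_ds x (S x z)).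

Let U0 := box eta xb 0 sb 0.
Let U1 := box e xb 0 0 0.

(** Substituting [S] for [s] carries nonvanishing of denominators from the (x, s) box to the (x, z)
    box. *)
Lemma den_sol_free ex a b c d : den (env_sol S) ex a b c d = den env_free ex a 0 (S a c) 0.
Proof.
  induction ex as [q|[|]|e1 IH1 e2 IH2|e1 IH1 e2 IH2|e1 IH1]; simpl; congruence.
Qed.

Lemma U1_U0 a b c d : U1 a b c d -> U0 a 0 (S a c) 0.
Proof.
  intros (Ha & _ & Hc & _). rewrite Rminus_0_r in Hc.
  destruct (HS a c Ha Hc) as (H1 & H2 & _). now apply U0_intro.
Qed.

Lemma wf_sol_free ex : wf env_free U0 ex -> wf (env_sol S) U1 ex.
Proof.
  induction ex as [q|t|e1 IH1 e2 IH2|e1 IH1 e2 IH2|e1 IH1]; simpl; try tauto.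
  intros [Hw H0]; split; [tauto|]. intros a b c d Hp.
  rewrite den_sol_free. apply H0. now apply U1_U0 with b d.
Qed.

Lemma wf_inv_eZs : wf env_free U0 (Inv eZs).
Proof.
  split; [now apply wf_ratio_ds|]. intros a b c d Hp. apply Rgt_not_eq, Hreg, Hp.
Qed.

Lemma wf_dv_sol i t : wf (env_sol S) U1 (dv_sol i t).
Proof.
  apply wf_sol_free.
  destruct i as [|[|[|i]]], t; cbn [dv_sol];
    lazymatch goal with |- wf _ _ (Cst _) => exact I | _ => idtac end.
  - apply wf_sopp, wf_smul; [now apply wf_ratio_dx|apply wf_inv_eZs].
  - apply wf_inv_eZs.
Qed.

Lemma differential_sol : differential xs (env_sol S) dv_sol U1.
Proof.
  split; [intros; apply wf_dv_sol|].
  intros i t a b c d Hi Hp. pose proof Hp as (Ha & _ & Hc & _). rewrite Rminus_0_r in Hc.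
  destruct (HS a c Ha Hc) as (_ & _ & _ & _ & Hx & Hz).
  destruct i as [|[|[|i]]], t.
  - simpl; rewrite Q2R_1; apply @is_derive_id.
  - unfold dv_sol. rewrite den_sopp, den_smul. cbn [den]. rewrite !den_sol_free.
    change (is_derive (fun x => S x c) a (- (ratio_dx a (S a c) * / ratio_ds a (S a c)))).
    replace (- (ratio_dx a (S a c) * / ratio_ds a (S a c)))
      with (- ratio_dx a (S a c) / ratio_ds a (S a c))
      by (unfold Rdiv; ring). exact Hx.
  - simpl; rewrite Q2R_0; apply @is_derive_const.
  - simpl; rewrite Q2R_0; apply @is_derive_const.
  - simpl; rewrite Q2R_0; apply @is_derive_const.
  - unfold dv_sol. cbn [den]. rewrite den_sol_free. exact Hz.
  - simpl; rewrite Q2R_0; apply @is_derive_const.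
  - simpl; rewrite Q2R_0; apply @is_derive_const.
Qed.

Lemma cont4_sol t : cont4 (env_sol S t) xb 0 0 0.
Proof.
  destruct t; unfold cont4, unc; simpl.
  - apply continuous_fst.
  - apply (continuous_comp (fun q : R * (R * (R * R)) => (fst q, fst (snd (snd q))))
             (fun p => S (fst p) (snd p))).
    + apply continuous_pair; [apply continuous_fst|].
      apply (continuous_comp snd (fun q : R * (R * R) => fst (snd q))); [apply continuous_snd|].
      apply (continuous_comp snd fst); [apply continuous_snd|apply continuous_fst].
    + apply (HS xb 0); rewrite ?Rminus_diag, ?Rabs_R0; assumption.
Qed.

Lemma base_sol t q : base_xs t = Some q -> env_sol S t xb 0 0 0 = Q2R q.
Proof.
  destruct t; simpl; intros [= <-]; rewrite ?HS0; unfold Q2R; simpl; lra.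
Qed.

Lemma wf_word w : wf (env_sol S) U1 (word_expr w).
Proof.
  induction w as [|[|] w IH].
  - apply wf_sol_free, wf_eF. intros a b c d Hp. apply Rgt_not_eq, Hreg, Hp.
  - apply wf_deriv; [intro; apply wf_dv_sol|exact IH].
  - apply wf_deriv; [intro; apply wf_dv_sol|exact IH].
Qed.

Definition word_fun (w : list bool) (x z : R) : R := den (env_sol S) (word_expr w) x 0 z 0.

Lemma U1_intro x z : Rabs (x - xb) < e -> Rabs z < e -> U1 x 0 z 0.
Proof. intros H1 H2; repeat split; rewrite ?Rminus_0_r, ?Rabs_R0; auto. Qed.

Lemma word_derive_x w x z : Rabs (x - xb) < e -> Rabs z < e ->
  is_derive (fun x => word_fun w x z) x (word_fun (true :: w) x z).
Proof.
  intros Hx Hz.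
  apply (den_deriv xs (env_sol S) dv_sol U1 differential_sol 0 (word_expr w) x 0 z 0);
    auto using U1_intro, wf_word.
Qed.

Lemma word_derive_z w x z : Rabs (x - xb) < e -> Rabs z < e ->
  is_derive (fun z => word_fun w x z) z (word_fun (false :: w) x z).
Proof.
  intros Hx Hz.
  apply (den_deriv xs (env_sol S) dv_sol U1 differential_sol 2 (word_expr w) x 0 z 0);
    auto using U1_intro, wf_word.
Qed.

Lemma word_continuous w : continuous (fun p => word_fun w (fst p) (snd p)) (xb, 0).
Proof.
  apply (continuous_comp (fun p : R * R => (fst p, (0, (snd p, 0))))
    (unc (den (env_sol S) (word_expr w)))).
  - repeat apply continuous_pair;
      first [apply continuous_fst|apply continuous_snd|apply continuous_const].
  - apply (cont4_den (env_sol S) U1); auto using wf_word, cont4_sol.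
    now apply box_center.
Qed.

Lemma word_value w q : evalQ base_xs (word_expr w) = Some q -> word_fun w xb 0 = Q2R q.
Proof.
  apply (evalQ_correct (env_sol S) U1); [now apply box_center|apply base_sol].
Qed.

Definition env_atom (t : atom) : fn4 :=
  match t with
  | ax => fun x _ _ _ => x
  | au => fun _ _ u _ => u
  | av => fun _ _ _ v => v
  | at_ w => fun x _ u v => word_fun w x (u ^ 2 / v ^ 2)
  end.

Lemma base_atom_correct t q : base_atom t = Some q -> env_atom t xb 0 0 1 = Q2R q.
Proof.
  destruct t as [| | |w]; cbn [base_atom env_atom];
    try (intros [= <-]; unfold Q2R; simpl; lra).
  replace (0 ^ 2 / 1 ^ 2) with 0 by field.
  intro H. apply word_value. revert H.
  (* Only words of length at most two carry a value; each is recomputed by evaluating the iterated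
     derivative at x = 5/8, s = 5/4. *)
  destruct w as [|[|] [|[|] [|]]]; intro H; try discriminate H; rewrite <- H;
    vm_compute; reflexivity.
Qed.

Lemma cont4_atom t : cont4 (env_atom t) xb 0 0 1.
Proof.
  assert (Cu : continuous (fun q : R * (R * (R * R)) => fst (snd (snd q))) (xb, (0, (0, 1)))).
  { apply (continuous_comp snd (fun q : R * (R * R) => fst (snd q))); [apply continuous_snd|].
    apply (continuous_comp snd fst); [apply continuous_snd|apply continuous_fst]. }
  assert (Cv : continuous (fun q : R * (R * (R * R)) => snd (snd (snd q))) (xb, (0, (0, 1)))).
  { apply (continuous_comp snd (fun q : R * (R * R) => snd (snd q))); [apply continuous_snd|].
    apply (continuous_comp snd snd); [apply continuous_snd|apply continuous_snd]. }
  destruct t as [| | |w]; unfold cont4, unc; cbn [env_atom]; auto; [apply continuous_fst|].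
  set (u := fun q : R * (R * (R * R)) => fst (snd (snd q))) in *.
  set (v := fun q : R * (R * (R * R)) => snd (snd (snd q))) in *.
  apply (continuous_comp (fun q : R * (R * (R * R)) => (fst q, (u q) ^ 2 / (v q) ^ 2))
    (fun p => word_fun w (fst p) (snd p))).
  - apply continuous_pair; [apply continuous_fst|].
    apply (continuous_ext (fun q => mult (mult (u q) (u q)) (/ (v q * v q)))).
    { intro q. unfold mult, Rdiv; simpl. now rewrite !Rmult_1_r. }
    apply (continuous_mult (fun q => mult (u q) (u q)) (fun q => / (v q * v q))).
    + apply (continuous_mult u u); assumption.
    + apply (continuous_comp (fun q => v q * v q) Rinv).
      * apply (continuous_mult v v); assumption.
      * apply continuity_pt_filterlim, (continuity_pt_inv id); [apply continuity_pt_id|].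
        unfold v, id; simpl; lra.
  - cbv beta.
    replace (u (xb, (0, (0, 1))) ^ 2 / v (xb, (0, (0, 1))) ^ 2) with 0
      by (unfold u, v; cbn [fst snd]; field).
    exact (word_continuous w).
Qed.

Variables (e2 : R).
Hypothesis He2 : 0 < e2 <= 1 / 2.
Hypothesis He2e : e2 <= e / 4.
Let U2 := box e2 xb 0 0 1.

Lemma U2_elim x y u v : U2 x y u v ->
  Rabs (x - xb) < e /\ 1 / 2 < v /\ Rabs (u ^ 2 / v ^ 2) < e.
Proof.
  intros (Hx & _ & Hu & Hv). rewrite Rminus_0_r in Hu.
  apply Rabs_lt_iff in Hu, Hv.
  assert (Hv2 : 1 / 2 < v) by lra.
  split; [lra|]. split; [assumption|].
  assert (Hvv : 1 / 4 < v ^ 2) by (clear - Hv2; nra).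
  assert (Q : 0 <= u ^ 2 / v ^ 2).
  { apply Rmult_le_pos; [apply pow2_ge_0|]. apply Rlt_le, Rinv_0_lt_compat; lra. }
  rewrite Rabs_pos_eq by assumption.
  apply Rmult_lt_reg_r with (v ^ 2); [lra|].
  replace (u ^ 2 / v ^ 2 * v ^ 2) with (u ^ 2) by (field; lra).
  assert (u ^ 2 <= e2 * e2) by (clear - Hu; nra).
  assert (e2 * e2 <= e / 4 * (1 / 2)) by (apply Rmult_le_compat; lra).
  assert (e * (1 / 4) < e * v ^ 2) by (apply Rmult_lt_compat_l; assumption).
  lra.
Qed.

Lemma wf_inv_v : wf env_atom U2 (Inv aV).
Proof.
  split; [exact I|]. intros a b c d Hp. destruct (U2_elim _ _ _ _ Hp) as (_ & H & _).
  simpl; lra.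
Qed.

Lemma differential_atom : differential atom env_atom dv_atom U2.
Proof.
  pose proof wf_inv_v as Hwv.
  split.
  - intros i t _. destruct i as [|[|[|[|i]]]], t; cbn [dv_atom wf aU] in *; tauto.
  - intros i t x y u v Hi Hp. destruct (U2_elim _ _ _ _ Hp) as (Hx & Hv & Hz).
    destruct i as [|[|[|[|i]]]]; [| | | |lia].
    + destruct t; simpl; rewrite ?Q2R_0, ?Q2R_1;
        first [apply @is_derive_const | apply @is_derive_id | now apply word_derive_x].
    + destruct t; simpl; rewrite ?Q2R_0; apply @is_derive_const.
    + destruct t; cbn [slice coord env_atom dv_atom den aU aV]; rewrite ?Q2R_0, ?Q2R_1;
        first [apply @is_derive_const | apply @is_derive_id | idtac].
      evar_last.
      { apply (is_derive_comp (fun z => word_fun w x z) (fun u => u ^ 2 / v ^ 2));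
          [now apply word_derive_z|]. auto_derive; [exact I|reflexivity]. }
      unfold scal, Q2R; simpl; unfold mult; simpl. field. lra.
    + destruct t; cbn [slice coord env_atom dv_atom den aU aV]; rewrite ?Q2R_0, ?Q2R_1;
        first [apply @is_derive_const | apply @is_derive_id | idtac].
      evar_last.
      { apply (is_derive_comp (fun z => word_fun w x z) (fun v => u ^ 2 / v ^ 2));
          [now apply word_derive_z|]. auto_derive; [nra|reflexivity]. }
      unfold scal, Q2R; simpl; unfold mult; simpl. field. lra.
Qed.

Lemma Lag_atoms x y u v : U2 x y u v -> Lag (199 / 128) x y u v = den env_atom eL x y u v.
Proof.
  intro Hp. destruct (U2_elim _ _ _ _ Hp) as (Hx & Hv & Hz).
  set (z := u ^ 2 / v ^ 2) in *.
  destruct (HS x z Hx Hz) as (Hxe & Hse & HZ & _). set (s := S x z) in *.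
  destruct (Hreg x 0 s 0) as [HD _]; [now apply U0_intro|].
  apply Rabs_lt_iff in Hxe, Hse.
  set (a := x ^ 2 / 2 + 199 / 128).
  assert (Ha : 1749 / 1000 < a < 1751 / 1000) by (unfold a; nra).
  assert (ED : den env_free eD x 0 s 0 = s ^ 3 * (a - s) - x ^ 2).
  { unfold eD. rewrite den_ssub. cbn [den eS eX env_free]. unfold eT. rewrite den_ssub.
    cbn [den eA eS eX env_free]. unfold a, Q2R; simpl. field. }
  rewrite ED in HD.
  assert (EZ : ratio x s =
    (x ^ 2 - (s * (a - s)) ^ 2) * x ^ 2 * s ^ 4 / (s ^ 3 * (a - s) - x ^ 2) ^ 2).
  { unfold ratio, eZ, eW. cbn [den]. rewrite ED, den_ssub. unfold eST. cbn [den].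
    unfold eT. rewrite den_ssub. cbn [den eA eS eX env_free].
    replace (Q2R (1 # 2) * (x * x) + Q2R (199 # 128)) with a by (unfold a, Q2R; simpl; field).
    field. lra. }
  assert (EF : word_fun [] x z = x ^ 2 * (s - (a - s)) / (s ^ 3 * (a - s) - x ^ 2)).
  { unfold word_fun. rewrite den_sol_free. fold s. unfold word_expr, eF. cbn [den].
    rewrite ED, den_ssub. unfold eT. rewrite den_ssub. cbn [den eA eS eX env_free].
    replace (Q2R (1 # 2) * (x * x) + Q2R (199 # 128)) with a by (unfold a, Q2R; simpl; field).
    field. lra. }
  (* The number 123/100 lies just below the base value s = 5/4: low enough for m (a - m) > x on the
     whole box, high enough for s (s + m - a) >= 909/1000, whose square exceeds 2 x^2. *)
  rewrite (Lag_formula (199 / 128) x y u v s (123 / 100)); fold a.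
  - unfold eL. cbn [den aV env_atom]. fold z. rewrite EF. unfold Q2R; simpl. field. lra.
  - lra.
  - lra.
  - lra.
  - lra.
  - nra.
  - lra.
  - exact HD.
  - rewrite <- EZ. exact HZ.
  - lra.
  - lra.
  - lra.
  - assert (B : 909 / 1000 <= s * (s + 123 / 100 - a)) by nra.
    replace (s ^ 2 * (s + 123 / 100 - a) ^ 2) with ((s * (s + 123 / 100 - a)) ^ 2) by ring.
    apply Rle_trans with ((909 / 1000) ^ 2); [nra|apply pow_incr; lra].
Qed.

End Atoms.

(** * Spray coefficients and flag curvature *)

Ltac prove_wf wD :=
  lazymatch goal with
  | |- wf _ _ (sadd _ _) => apply wf_sadd; prove_wf wD
  | |- wf _ _ (ssub _ _) => apply wf_ssub; prove_wf wD
  | |- wf _ _ (smul _ _) => apply wf_smul; prove_wf wD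
  | |- wf _ _ (dif _ _) => apply wD; [assumption|lia|prove_wf wD]
  | |- _ => auto
  end.

Theorem theoremB :
  exists c x y u v : R,
    3 / 2 < c /\ 0 < x /\ v <> 0 /\
    (exists e, 0 < e /\ HasPartials 4 (box e x y u v) (Lag c)) /\
    Kflag c x y u v < 0.
Proof.
  destruct positivity_region as (eta & Heta & Hreg).
  destruct (ratio_inverse eta Heta Hreg) as (S & e & He & HS0 & HS).
  set (E := env_atom S).
  set (L := Lag (199 / 128)).
  set (e1 := Rmin (1 / 2) (e / 4)).
  pose proof (Rmin_l (1 / 2) (e / 4)) as M1. pose proof (Rmin_r (1 / 2) (e / 4)) as M2.
  fold e1 in M1, M2.
  assert (He1 : 0 < e1 <= 1 / 2) by (split; [apply Rmin_pos|]; lra).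
  pose proof (differential_atom eta S e Heta Hreg He HS e1 He1 M2) as Hd1. fold E in Hd1.
  assert (wD : forall U i e, differential atom E dv_atom U -> (i < 4)%nat -> wf E U e ->
     wf E U (dif i e)).
  { intros U i ex [Hd _] Hi Hw. apply wf_deriv; auto. }
  assert (wL : forall U, wf E U eL) by (intro; simpl; tauto).
  assert (wDm : forall U, differential atom E dv_atom U -> wf E U eDm).
  { intros U Hd. unfold eDm. prove_wf wD. }
  (* The spray coefficients divide by the Hessian determinant and are differentiated twice, so it
     must be nonzero on a box; at the base point it is 12/125. *)
  destruct (cont4_pos (den E eDm) xb 0 0 1) as (e2 & He2 & Hpos).
  { apply (cont4_den E (box e1 xb 0 0 1)); [apply box_center, He1| |apply wDm, Hd1].
    intro t. exact (cont4_atom eta S e Heta Hreg He HS t). }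
  { rewrite (evalQ_correct E (box e1 xb 0 0 1) base_atom eDm _ _ _ _ (12 # 125)%Q).
    - unfold Q2R; simpl; lra.
    - apply box_center, He1.
    - exact (base_atom_correct S e He HS0).
    - vm_compute; reflexivity. }
  set (e3 := Rmin e1 e2).
  pose proof (Rmin_l e1 e2) as M3. pose proof (Rmin_r e1 e2) as M4. fold e3 in M3, M4.
  assert (He3 : 0 < e3) by (apply Rmin_pos; lra).
  set (U := box e3 xb 0 0 1).
  assert (HU : open4 U) by apply box_open.
  assert (Hc : U xb 0 0 1) by now apply box_center.
  assert (Hd : differential atom E dv_atom U).
  { apply (differential_atom eta S e Heta Hreg He HS e3); lra. }
  assert (RL : represents atom E U L eL).
  { split; [apply wL|]. intros x y u v Hp.
    apply (Lag_atoms eta S e Heta Hreg He HS e3); auto; lra. }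
  assert (Rpd : forall i f ex, (i < 4)%nat -> represents atom E U f ex ->
     represents atom E U (pd i f) (dif i ex)).
  { intros i f ex. apply (represents_pd atom E dv_atom U HU Hd). }
  assert (V1 : forall i x y u v, U x y u v -> (i < 4)%nat ->
     pd i L x y u v = den E (dif i eL) x y u v) by (intros; now apply Rpd).
  assert (V2 : forall i j x y u v, U x y u v -> (i < 4)%nat -> (j < 4)%nat ->
     pd i (pd j L) x y u v = den E (dif i (dif j eL)) x y u v) by (intros; now apply Rpd; auto).
  assert (RD : represents atom E U (Dm (199 / 128)) eDm).
  { split; [now apply wDm|]. intros x y u v Hp. unfold Dm. fold L.
    rewrite !V2 by (assumption || lia).
    unfold eDm. rewrite den_ssub, !den_smul. ring. }
  assert (wI : wf E U (Mul (Cst (1 # 2)) (Inv eDm))).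
  { split; [exact I|]. split; [now apply wDm|]. intros x y u v Hp.
    apply Rgt_not_eq, Hpos. eapply box_mono; [|exact Hp]. lra. }
  assert (Hhalf : Q2R (1 # 2) = / 2) by (unfold Q2R; simpl; lra).
  assert (RG : represents atom E U (Gsp (199 / 128)) eG).
  { split.
    - unfold eG. prove_wf wD.
    - intros x y u v Hp. unfold Gsp. cbv zeta. fold L.
      rewrite (proj2 RD x y u v Hp).
      rewrite !V2, !V1 by (assumption || lia).
      unfold eG. rewrite den_smul, den_sadd, !den_ssub, !den_smul. cbn [den]. now rewrite Hhalf. }
  assert (RH : represents atom E U (Hsp (199 / 128)) eH).
  { split.
    - unfold eH. prove_wf wD.
    - intros x y u v Hp. unfold Hsp. cbv zeta. fold L.
      rewrite (proj2 RD x y u v Hp).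
      rewrite !V2, !V1 by (assumption || lia).
      unfold eH. rewrite den_smul, den_sadd, !den_ssub, !den_smul. cbn [den]. now rewrite Hhalf. }
  exists (199 / 128), xb, 0, 0, 1.
  split; [lra|]. split; [lra|]. split; [lra|]. split.
  (* Order four is what the curvature uses: two derivatives of G, which already contains second
     derivatives of the Lagrangian. *)
  - exists e3. split; [exact He3|].
    exact (HasPartials_represents atom E dv_atom U HU Hd 4 L eL RL).
  - assert (EK : Kflag (199 / 128) xb 0 0 1 = den E eK xb 0 0 1).
    { unfold Kflag. cbv zeta. fold L.
      pose proof (Rpd 2%nat _ _ ltac:(lia) RG) as RG2.
      pose proof (Rpd 3%nat _ _ ltac:(lia) RG) as RG3.
      pose proof (Rpd 2%nat _ _ ltac:(lia) RH) as RH2.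
      pose proof (Rpd 3%nat _ _ ltac:(lia) (Rpd 0%nat _ _ ltac:(lia) RG)) as RG03.
      pose proof (Rpd 2%nat _ _ ltac:(lia) (Rpd 1%nat _ _ ltac:(lia) RG)) as RG12.
      pose proof (Rpd 2%nat _ _ ltac:(lia) RG2) as RG22.
      pose proof (Rpd 3%nat _ _ ltac:(lia) RG2) as RG23.
      unfold eK. rewrite den_curvature_expr. cbv zeta.
      rewrite (proj2 RG03 _ _ _ _ Hc), (proj2 RG12 _ _ _ _ Hc), (proj2 RG22 _ _ _ _ Hc),
        (proj2 RG23 _ _ _ _ Hc), (proj2 RG2 _ _ _ _ Hc), (proj2 RG3 _ _ _ _ Hc),
        (proj2 RH2 _ _ _ _ Hc), (proj2 RG _ _ _ _ Hc), (proj2 RH _ _ _ _ Hc),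
        (V1 3%nat _ _ _ _ Hc ltac:(lia)).
      reflexivity. }
    rewrite EK, (evalQ_correct E U base_atom eK _ _ _ _ (-25 # 6)%Q Hc).
    + unfold Q2R; simpl; lra.
    + exact (base_atom_correct S e He HS0).
    + exact eK_value.
Qed.
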